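(* Let $(V,u)$ be a unital vector lattice. The following are equivalent. (i) $V$ is hyperarchimedean. (ii) There exists a Boolean space $X$ such that $(V,u)$ is isomorphic, as a unital vector lattice, to $(\mathrm{LC}(X),1_X)$. Further, any Boolean space $X$ satisfying (ii) is homeomorphic to the maximal spectrum $\mathbf{MaxSpec}\,V$, and is therefore uniquely determined by $(V,u)$ to within a homeomorphism.
   Context: A vector lattice is a lattice-ordered real vector space. A unital vector lattice $(V,u)$ is a vector lattice $V$ with a distinguished weak unit $u\ge 0$, i.e. $u\wedge v=0$ implies $v=0$ for all $v\in V$; morphisms $(V,u)\to(V',u')$ are linear lattice homomorphisms carrying $u$ to $u'$. $V$ is Archimedean if $0<v\le w$ implies $nv\not\le w$ for some positive integer $n$; $V$ is hyperarchimedean if all of its homomorphic images are Archimedean. A Boolean space is a compact Hausdorff totally disconnected topological space. A function $f\colon X\to\mathbb{R}$ is locally constant if each $x\in X$ has an open neighbourhood on which $f$ is constant. $\mathrm{LC}(X)$ is the set of all locally constant functions $X\to\mathbb{R}$, with pointwise vector lattice operations and distinguished unit $1_X$, the constant function $1$. An ideal of $(V,u)$ is the kernel of a homomorphism of unital vector lattices, i.e. an order-convex sublattice subgroup $K$ of $V$ such that $a\wedge u\in K$ implies $a\in K$ for all $a\ge0$. A proper ideal $\mathfrak{p}$ is prime if $V/\mathfrak{p}$ is totally ordered; a proper ideal is maximal if the quotient is totally ordered and Archimedean (equivalently, if it is inclusion-maximal among proper ideals). $\mathbf{Spec}\,V$ is the set of prime ideals with the topology having as a basis of closed sets the sets $\{\mathfrak{p}\in\mathbf{Spec}\,V\mid\mathfrak{p}\supseteq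 P\}$, $P$ ranging over principal (singly generated) ideals of $V$. $\mathbf{MaxSpec}\,V$ is its subspace of maximal ideals. *)

(* Defs.v *)
From HB Require Import structures.
From mathcomp Require Import all_boot all_order all_algebra.
From mathcomp Require Import generic_quotient.
From mathcomp Require Import boolp classical_sets functions reals.
From mathcomp Require Import topology.

Set Implicit Arguments.
Unset Strict Implicit.
Unset Printing Implicit Defensive.

Import Order.TTheory GRing.Theory Num.Theory.

Local Open Scope ring_scope.

(* The order is a field of the mixin, rather than inherited from
   [Order.Lattice]: a new structure below both [GRing.Lmodule] and
   [Order.Lattice] would be a second minimal join of the additive and the
   lattice hierarchies, next to [Num.RealDomain], which Hierarchy Builder
   rejects. The library's order and lattice structures are recovered on the
   carrier right after. *)
HB.mixin Record Lmodule_isVectorLattice (R : realType) V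
    of GRing.Lmodule R V := {
  vle : rel V;
  vmeet : V -> V -> V;
  vjoin : V -> V -> V;
  vle_refl : reflexive vle;
  vle_anti : antisymmetric vle;
  vle_trans : transitive vle;
  vmeetP : forall x y z, vle x (vmeet y z) = vle x y && vle x z;
  vjoinP : forall x y z, vle (vjoin x y) z = vle x z && vle y z;
  vle_add2l : forall z x y, vle x y -> vle (z + x) (z + y);
  vle_scale : forall (r : R) x y, 0 <= r -> vle x y -> vle (r *: x) (r *: y)
}.

#[short(type="vectorLatticeType")]
HB.structure Definition VectorLattice (R : realType) :=
  { V of GRing.Lmodule R V & Lmodule_isVectorLattice R V }.

HB.instance Definition _ (R : realType) (V : vectorLatticeType R) :=
  Order.Le_isPOrder.Build ring_display (VectorLattice.sort V)
    vle_refl vle_anti vle_trans.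
HB.instance Definition _ (R : realType) (V : vectorLatticeType R) :=
  Order.POrder_MeetJoin_isLattice.Build ring_display (VectorLattice.sort V)
    vmeetP vjoinP.

Section VectorLatticeTheory.
Variables (R : realType) (V : vectorLatticeType R).
Implicit Types (x y z : V) (r : R).

Lemma lev_add2l z x y : x <= y -> z + x <= z + y.
Proof. exact: vle_add2l. Qed.

Lemma lev_scale r x y : 0 <= r -> x <= y -> r *: x <= r *: y.
Proof. exact: vle_scale. Qed.

Lemma lev_add2lE z x y : (z + x <= z + y) = (x <= y).
Proof.
apply/idP/idP; last exact: lev_add2l.
by move/(lev_add2l (- z)); rewrite !addKr.
Qed.

Lemma lev_add2rE z x y : (x + z <= y + z) = (x <= y).
Proof. by rewrite ![_ + z]addrC lev_add2lE. Qed.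

Lemma lev_subl x y z : (x - y <= z) = (x <= z + y).
Proof. by rewrite -(lev_add2rE y (x - y) z) subrK. Qed.

Lemma lev_opp2 x y : (- y <= - x) = (x <= y).
Proof. by rewrite -(lev_add2rE x (- y)) addNr -(lev_add2lE y (- y + x)) addr0 addrA subrr add0r. Qed.

Lemma lev_add x y z t : x <= y -> z <= t -> x + z <= y + t.
Proof.
by move=> xy zt; apply: (@le_trans _ _ (y + z));
  rewrite ?lev_add2rE ?lev_add2lE.
Qed.

Lemma addv_meet z x y : z + (x `&` y)%O = ((z + x) `&` (z + y))%O.
Proof.
apply/eqP; rewrite eq_le lexI !lev_add2lE leIl leIr /=.
by rewrite [X in _ <= X]addrC -lev_subl lexI !lev_subl ![_ + z]addrC leIl leIr.
Qed.

Lemma addv_join z x y : z + (x `|` y)%O = ((z + x) `|` (z + y))%O.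
Proof.
apply/eqP; rewrite eq_le [X in _ && X]leUx !lev_add2lE leUl leUr andbT.
have h w j : (z + w <= j) = (w <= j - z).
  by rewrite -(lev_add2rE (- z) (z + w)) addrAC subrr add0r.
by rewrite h leUx -h leUl -h leUr.
Qed.

Lemma oppv_meet x y : - (x `&` y)%O = ((- x) `|` (- y))%O.
Proof.
apply/eqP; rewrite eq_le [X in _ && X]leUx !lev_opp2 leIl leIr !andbT.
have h (a b : V) : - a <= b -> - b <= a by rewrite -lev_opp2 opprK.
by apply: (h); rewrite lexI; apply/andP; split; apply: (h); rewrite (leUl, leUr).
Qed.

Lemma scalev_meet r x y : 0 <= r ->
  r *: (x `&` y)%O = ((r *: x) `&` (r *: y))%O.
Proof.
rewrite le_eqVlt => /predU1P[<-|r0]; first by rewrite !scale0r meetxx.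
have r0' := ltW r0; have rI0 : 0 <= r^-1 by rewrite invr_ge0.
apply/eqP; rewrite eq_le lexI !lev_scale ?leIl ?leIr//=.
have rK w : r^-1 *: (r *: w) = w by rewrite scalerA mulVf ?gt_eqF ?scale1r.
have Kr w : r *: (r^-1 *: w) = w by rewrite scalerA divff ?gt_eqF ?scale1r.
rewrite -[X in X <= _]Kr lev_scale// lexI.
apply/andP; split; rewrite -[X in _ <= X]rK lev_scale//; first exact: leIl.
exact: leIr.
Qed.

Definition absv x : V := (x `|` - x)%O.

Lemma absv_ge0 x : 0 <= absv x.
Proof.
have h : 0 <= (2^-1 : R) by rewrite invr_ge0 ler0n.
have : 0 <= absv x + absv x.
  by rewrite -(subrr x) lev_add ?leUl ?leUr.
move=> /(lev_scale h); rewrite scaler0 -mulr2n -scaler_nat.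
by rewrite scalerA mulVf ?pnatr_eq0// scale1r.
Qed.

Lemma lev_abs x : x <= absv x. Proof. exact: leUl. Qed.
Lemma lev_Nabs x : - absv x <= x.
Proof. by rewrite -lev_opp2 opprK leUr. Qed.

End VectorLatticeTheory.

Section Morphisms.
Variables (R : realType) (V W : vectorLatticeType R).

Definition is_vlhom (f : V -> W) : Prop :=
  [/\ linear f, {morph f : x y / (x `&` y)%O} & {morph f : x y / (x `|` y)%O}].

Definition is_uvlhom (u : V) (u' : W) (f : V -> W) : Prop :=
  is_vlhom f /\ f u = u'.

End Morphisms.

Definition uvl_isomorphic (R : realType) (V W : vectorLatticeType R)
    (u : V) (u' : W) : Prop :=
  exists (f : V -> W) (g : W -> V),
    [/\ is_uvlhom u u' f, is_uvlhom u' u g, cancel f g & cancel g f].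

Definition weak_unit (R : realType) (V : vectorLatticeType R) (u : V) : Prop :=
  0 <= u /\ forall v : V, (u `&` v)%O = 0 :> V -> v = 0.

Definition archimedean (R : realType) (V : vectorLatticeType R) : Prop :=
  forall v w : V, 0 < v -> v <= w -> exists2 n, (0 < n)%N & ~~ (v *+ n <= w).

Definition hyperarchimedean (R : realType) (V : vectorLatticeType R) : Prop :=
  forall (W : vectorLatticeType R) (f : V -> W),
    is_vlhom f -> (forall w, exists v, f v = w) -> archimedean W.

(* Kernels of homomorphisms of vector lattices. Closure under scalars is not
   required: it is lemma [vlidealZ] below. *)
Record vlideal (R : realType) (V : vectorLatticeType R) := VLIdeal {
  vlideal_set :> V -> Prop;
  vlideal0 : vlideal_set 0;
  vlidealB : forall a b, vlideal_set a -> vlideal_set b -> vlideal_set (a - b);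
  vlidealI : forall a b,
    vlideal_set a -> vlideal_set b -> vlideal_set (a `&` b)%O;
  vlidealU : forall a b,
    vlideal_set a -> vlideal_set b -> vlideal_set (a `|` b)%O;
  vlideal_convex : forall a b c,
    vlideal_set a -> vlideal_set c -> a <= b -> b <= c -> vlideal_set b
}.

(* Kernels of homomorphisms of unital vector lattices. *)
Record ideal (R : realType) (V : vectorLatticeType R) (u : V) := Ideal {
  ideal_vlideal :> vlideal V;
  ideal_unit : forall a : V, 0 <= a ->
    ideal_vlideal (a `&` u)%O -> ideal_vlideal a
}.

Section Quotient.
Variables (R : realType) (V : vectorLatticeType R) (K : vlideal V).
Implicit Types (a b c : V) (r : R).

Lemma vlidealN a : K a -> K (- a).
Proof. by move=> Ka; rewrite -sub0r; apply: vlidealB => //; apply: vlideal0. Qed.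

Lemma vlidealD a b : K a -> K b -> K (a + b).
Proof. by move=> Ka Kb; rewrite -[b]opprK; apply: vlidealB => //; apply: vlidealN. Qed.

Lemma vlidealMn a n : K a -> K (a *+ n).
Proof.
move=> Ka; elim: n => [|n IHn]; first by rewrite mulr0n; apply: vlideal0.
by rewrite mulrS; apply: vlidealD.
Qed.

Lemma vlideal_abs a : K (absv a) <-> K a.
Proof.
split=> [Ka|Ka]; last by apply: vlidealU => //; apply: vlidealN.
apply: (vlideal_convex (vlidealN Ka) Ka); [exact: lev_Nabs|exact: lev_abs].
Qed.

Lemma vlideal_squeeze k b : K k -> - k <= b -> b <= k -> K b.
Proof. by move=> Kk; apply: vlideal_convex => //; apply: vlidealN. Qed.

Lemma vlidealZ r a : K a -> K (r *: a).
Proof.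
have pos s : 0 <= s -> K a -> K (s *: a).
  move=> s0 Ka; pose n := Num.bound s.
  have sn : s <= n%:R.
    by rewrite ltW// archi_boundP.
  have Kabs : K (absv a) by apply/vlideal_abs.
  have sabs : s *: absv a <= absv a *+ n.
    rewrite -scaler_nat -(subrK s n%:R) scalerDl -[X in X <= _]add0r lev_add2rE.
    by rewrite -(scaler0 _ (n%:R - s)) lev_scale ?subr_ge0 ?absv_ge0.
  apply: (@vlideal_squeeze (absv a *+ n)); first exact: vlidealMn.
    apply: (@le_trans _ _ (s *: (- absv a))).
      by rewrite scalerN lev_opp2.
    by rewrite lev_scale// lev_Nabs.
  by apply: le_trans sabs; rewrite lev_scale// lev_abs.
have [r0|/ltW r0] := lerP 0 r; first exact: pos.
move=> Ka; rewrite -[r]opprK scaleNr; apply: vlidealN.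
by apply: pos; rewrite ?oppr_ge0.
Qed.

Definition quot_equiv a b : bool := `[< K (a - b) >].

Lemma quot_equiv_refl : reflexive quot_equiv.
Proof. by move=> a; apply/asboolP; rewrite subrr; apply: vlideal0. Qed.

Lemma quot_equiv_sym : symmetric quot_equiv.
Proof.
by move=> a b; apply/asboolP/asboolP => /vlidealN; rewrite opprB.
Qed.

Lemma quot_equiv_trans : transitive quot_equiv.
Proof.
move=> b a c /asboolP Kab /asboolP Kbc; apply/asboolP.
by rewrite -(subrK b a) -addrA; apply: vlidealD.
Qed.

Canonical quot_equivRel :=
  EquivRel quot_equiv quot_equiv_refl quot_equiv_sym quot_equiv_trans.

Definition quot := {eq_quot quot_equivRel}%qT.
HB.instance Definition _ := Choice.on quot.

Definition quot_pi a : quot := (\pi_quot a)%qT.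
Definition quot_repr (x : quot) : V := repr x.

Lemma quot_piP a b : quot_pi a = quot_pi b <-> K (a - b).
Proof.
have -> : (quot_pi a = quot_pi b) <-> is_true (quot_equiv a b).
  by split=> /(@eqquotP _ _ quot a b).
by split=> /asboolP.
Qed.

Lemma quot_reprK x : quot_pi (quot_repr x) = x.
Proof. exact: reprK. Qed.

Lemma quot_piW (P : quot -> Prop) : (forall a, P (quot_pi a)) -> forall x, P x.
Proof. by move=> h x; rewrite -(quot_reprK x). Qed.

Definition quot_add x y := quot_pi (quot_repr x + quot_repr y).
Definition quot_opp x := quot_pi (- quot_repr x).
Definition quot_scale r x := quot_pi (r *: quot_repr x).
Definition quot_meet x y := quot_pi (quot_repr x `&` quot_repr y)%O.
Definition quot_join x y := quot_pi (quot_repr x `|` quot_repr y)%O.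
Definition quot_le x y := quot_meet x y == x.

Lemma quot_repr_pi a : K (quot_repr (quot_pi a) - a).
Proof. by apply/quot_piP; rewrite quot_reprK. Qed.

Lemma quot_addE a b : quot_add (quot_pi a) (quot_pi b) = quot_pi (a + b).
Proof.
by apply/quot_piP; rewrite opprD addrACA; apply: vlidealD; apply: quot_repr_pi.
Qed.

Lemma quot_oppE a : quot_opp (quot_pi a) = quot_pi (- a).
Proof.
by apply/quot_piP; rewrite -opprD; apply/vlidealN/quot_repr_pi.
Qed.

Lemma quot_scaleE r a : quot_scale r (quot_pi a) = quot_pi (r *: a).
Proof. by apply/quot_piP; rewrite -scalerBr; apply/vlidealZ/quot_repr_pi. Qed.

Lemma quot_meetE a b : quot_meet (quot_pi a) (quot_pi b) = quot_pi (a `&` b)%O.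
Proof.
apply/quot_piP; set a' := quot_repr _; set b' := quot_repr _.
pose k := absv (a' - a) + absv (b' - b).
have Ka : K (absv (a' - a)) by apply/vlideal_abs/quot_repr_pi.
have Kb : K (absv (b' - b)) by apply/vlideal_abs/quot_repr_pi.
have ka : absv (a' - a) <= k by rewrite -[X in X <= _]addr0 lev_add2lE absv_ge0.
have kb : absv (b' - b) <= k by rewrite -[X in X <= _]add0r lev_add2rE absv_ge0.
apply: (@vlideal_squeeze k); first exact: vlidealD.
- rewrite -lev_opp2 opprK opprB lev_subl addv_meet lexI; apply/andP; split.
    rewrite leIxl// -lev_subl; apply: le_trans ka.
    by rewrite -opprB -lev_opp2 opprK lev_Nabs.
  rewrite leIxr// -lev_subl; apply: le_trans kb.
  by rewrite -opprB -lev_opp2 opprK lev_Nabs.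
- rewrite lev_subl addv_meet lexI; apply/andP; split.
    by rewrite leIxl// -lev_subl; apply: le_trans ka; apply: lev_abs.
  by rewrite leIxr// -lev_subl; apply: le_trans kb; apply: lev_abs.
Qed.

Lemma joinv_oppE a b : (a `|` b)%O = - ((- a) `&` (- b))%O.
Proof. by rewrite oppv_meet !opprK. Qed.

Lemma quot_joinE a b : quot_join (quot_pi a) (quot_pi b) = quot_pi (a `|` b)%O.
Proof.
rewrite /quot_join !joinv_oppE -!quot_oppE -!quot_meetE -!quot_oppE.
by rewrite !quot_reprK.
Qed.

Lemma quot_addA : associative quot_add.
Proof.
by elim/quot_piW=> a; elim/quot_piW=> b; elim/quot_piW=> c; rewrite !quot_addE addrA.
Qed.
Lemma quot_addC : commutative quot_add.
Proof. by elim/quot_piW=> a; elim/quot_piW=> b; rewrite !quot_addE addrC. Qed.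
Lemma quot_add0 : left_id (quot_pi 0) quot_add.
Proof. by elim/quot_piW=> a; rewrite !quot_addE add0r. Qed.
Lemma quot_addN : left_inverse (quot_pi 0) quot_opp quot_add.
Proof. by elim/quot_piW=> a; rewrite quot_oppE quot_addE addNr. Qed.

HB.instance Definition _ := GRing.isZmodule.Build quot
  quot_addA quot_addC quot_add0 quot_addN.

Lemma quot_piD a b : quot_pi (a + b) = quot_pi a + quot_pi b.
Proof. exact/esym/quot_addE. Qed.

Lemma quot_scaleA r s x : quot_scale r (quot_scale s x) = quot_scale (r * s) x.
Proof. by elim/quot_piW: x => a; rewrite !quot_scaleE scalerA. Qed.
Lemma quot_scale1 : left_id 1 quot_scale.
Proof. by elim/quot_piW=> a; rewrite !quot_scaleE scale1r. Qed.
Lemma quot_scaleDr : right_distributive quot_scale +%R.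
Proof.
move=> r; elim/quot_piW=> a; elim/quot_piW=> b.
by rewrite -quot_piD !quot_scaleE -quot_piD scalerDr.
Qed.
Lemma quot_scaleDl x : {morph quot_scale^~ x : r s / r + s}.
Proof.
elim/quot_piW: x => a r s.
by rewrite /= !quot_scaleE -quot_piD scalerDl.
Qed.

HB.instance Definition _ := GRing.Zmodule_isLmodule.Build R quot
  quot_scaleA quot_scale1 quot_scaleDr quot_scaleDl.

Lemma quot_piZ r a : quot_pi (r *: a) = r *: quot_pi a.
Proof. exact/esym/quot_scaleE. Qed.

Lemma quot_meetC : commutative quot_meet.
Proof. by elim/quot_piW=> a; elim/quot_piW=> b; rewrite !quot_meetE meetC. Qed.
Lemma quot_joinC : commutative quot_join.
Proof. by elim/quot_piW=> a; elim/quot_piW=> b; rewrite !quot_joinE joinC. Qed.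
Lemma quot_meetA : associative quot_meet.
Proof.
by elim/quot_piW=> a; elim/quot_piW=> b; elim/quot_piW=> c;
  rewrite !quot_meetE meetA.
Qed.
Lemma quot_joinA : associative quot_join.
Proof.
by elim/quot_piW=> a; elim/quot_piW=> b; elim/quot_piW=> c;
  rewrite !quot_joinE joinA.
Qed.
Lemma quot_joinKI y x : quot_meet x (quot_join x y) = x.
Proof.
by elim/quot_piW: x => a; elim/quot_piW: y => b;
  rewrite quot_joinE quot_meetE joinKI.
Qed.
Lemma quot_meetKU y x : quot_join x (quot_meet x y) = x.
Proof.
by elim/quot_piW: x => a; elim/quot_piW: y => b;
  rewrite quot_meetE quot_joinE meetKU.
Qed.

Lemma quot_le_refl : reflexive quot_le.
Proof. by elim/quot_piW=> a; rewrite /quot_le quot_meetE meetxx. Qed.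
Lemma quot_le_anti : antisymmetric quot_le.
Proof. by move=> x y /andP[/eqP xy /eqP yx]; rewrite -xy quot_meetC. Qed.
Lemma quot_le_trans : transitive quot_le.
Proof.
by move=> y x z /eqP xy /eqP yz; apply/eqP; rewrite -{1}xy -quot_meetA yz.
Qed.

Lemma quot_meetP x y z : quot_le x (quot_meet y z) = quot_le x y && quot_le x z.
Proof.
have lel u v : quot_le (quot_meet u v) u.
  by rewrite /quot_le quot_meetC quot_meetA; elim/quot_piW: u => u;
    rewrite quot_meetE meetxx.
apply/idP/andP => [xyz|[/eqP xy /eqP xz]]; last first.
  by rewrite /quot_le quot_meetA xy xz.
split; apply: quot_le_trans xyz _; first exact: lel.
by rewrite quot_meetC; apply: lel.
Qed.

Lemma quot_leEjoin x y : quot_le x y = (quot_join x y == y).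
Proof.
apply/eqP/eqP => <-; last exact: quot_joinKI.
by rewrite quot_joinC quot_meetC quot_meetKU.
Qed.

Lemma quot_joinP x y z : quot_le (quot_join x y) z = quot_le x z && quot_le y z.
Proof.
have leu u v : quot_le u (quot_join u v) by rewrite /quot_le quot_joinKI.
apply/idP/andP => [xyz|[]]; last first.
  by rewrite !quot_leEjoin -quot_joinA => /eqP xz /eqP ->; rewrite xz.
split; apply: quot_le_trans _ xyz; first exact: leu.
by rewrite quot_joinC; apply: leu.
Qed.

Lemma quot_le_add2l (z x y : quot) : quot_le x y -> quot_le (z + x) (z + y).
Proof.
elim/quot_piW: x => a; elim/quot_piW: y => b; elim/quot_piW: z => c.
rewrite /quot_le quot_meetE => /eqP ab; apply/eqP.
by rewrite -!quot_piD quot_meetE -addv_meet quot_piD ab quot_piD.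
Qed.

Lemma quot_le_scale r (x y : quot) :
  0 <= r -> quot_le x y -> quot_le (r *: x) (r *: y).
Proof.
elim/quot_piW: x => a; elim/quot_piW: y => b r0.
rewrite /quot_le quot_meetE => /eqP ab; apply/eqP.
by rewrite -!quot_piZ quot_meetE -scalev_meet// quot_piZ ab quot_piZ.
Qed.

HB.instance Definition _ := Lmodule_isVectorLattice.Build R quot
  quot_le_refl quot_le_anti quot_le_trans quot_meetP quot_joinP
  quot_le_add2l quot_le_scale.
HB.instance Definition _ :=
  Order.Lattice.copy quot (VectorLattice.sort (quot : vectorLatticeType R)).

Lemma quot_pi_vlhom : is_vlhom quot_pi.
Proof.
split=> [r a b|a b|a b]; first by rewrite quot_piD quot_piZ.
- exact/esym/quot_meetE.
- exact/esym/quot_joinE.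
Qed.

End Quotient.

Section LocallyConstant.
Variables (X : topologicalType) (R : realType).
Implicit Types f g h : X -> R.

Definition locally_constant f : Prop :=
  forall x, exists2 U : set X, open_nbhs x U & forall y, U y -> f y = f x.

Definition lc_pred : {pred X -> R} := fun f => `[< locally_constant f >].

Record LC := MkLC { LC_fun :> X -> R; LC_funP : LC_fun \in lc_pred }.

HB.instance Definition _ := [isSub for LC_fun].
HB.instance Definition _ := [Choice of LC by <:].

Lemma lc_predP f : reflect (locally_constant f) (f \in lc_pred).
Proof. exact: asboolP. Qed.

Lemma lc_cst (c : R) : (fun=> c) \in lc_pred.
Proof.
apply/lc_predP => x; exists setT => //; split => //; exact: openT.
Qed.

Lemma lc_op2 (op : R -> R -> R) f g : f \in lc_pred -> g \in lc_pred ->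
  (fun x => op (f x) (g x)) \in lc_pred.
Proof.
move=> /lc_predP Pf /lc_predP Pg; apply/lc_predP => x.
have [U [oU Ux] fU] := Pf x; have [W [oW Wx] gW] := Pg x.
exists (U `&` W)%classic; first by split; [exact: openI|split].
by move=> y [Uy Wy]; rewrite fU// gW.
Qed.

Lemma lc_zmod_closed : zmod_closed lc_pred.
Proof.
split; first exact: (lc_cst 0).
by move=> f g; apply: (lc_op2 (fun s t => s - t)).
Qed.

HB.instance Definition _ := GRing.SubChoice_isSubZmodule.Build (X -> R)
  lc_pred LC lc_zmod_closed.

Implicit Types F G H : LC.

Definition LC_scale (r : R) (f : LC) : LC :=
  MkLC (lc_op2 (fun _ t => r * t) (LC_funP f) (LC_funP f)).

Lemma LC_scaleA r s F : LC_scale r (LC_scale s F) = LC_scale (r * s) F.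
Proof. by apply/val_inj/funext => x /=; rewrite mulrA. Qed.
Lemma LC_scale1 : left_id 1 LC_scale.
Proof. by move=> F; apply/val_inj/funext => x /=; rewrite mul1r. Qed.
Lemma LC_scaleDr : right_distributive LC_scale +%R.
Proof. by move=> r F G; apply/val_inj/funext => x; apply: mulrDr. Qed.
Lemma LC_scaleDl F : {morph LC_scale^~ F : r s / r + s}.
Proof. by move=> r s; apply/val_inj/funext => x; apply: mulrDl. Qed.

HB.instance Definition _ := GRing.Zmodule_isLmodule.Build R LC
  LC_scaleA LC_scale1 LC_scaleDr LC_scaleDl.

Definition LC_le (F G : LC) : bool := `[< forall x, F x <= G x >].
Definition LC_meet (F G : LC) : LC := MkLC (lc_op2 Num.min (LC_funP F) (LC_funP G)).
Definition LC_join (F G : LC) : LC := MkLC (lc_op2 Num.max (LC_funP F) (LC_funP G)).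

Lemma LC_le_refl : reflexive LC_le.
Proof. by move=> F; apply/asboolP. Qed.

Lemma LC_le_anti : antisymmetric LC_le.
Proof.
move=> F G /andP[/asboolP fg /asboolP gf]; apply/val_inj/funext => x /=.
by apply/eqP; rewrite eq_le fg gf.
Qed.

Lemma LC_le_trans : transitive LC_le.
Proof.
by move=> G F H /asboolP fg /asboolP gh; apply/asboolP => x; apply: le_trans (gh x).
Qed.

Lemma LC_meetP F G H : LC_le F (LC_meet G H) = LC_le F G && LC_le F H.
Proof.
apply/asboolP/andP => [hyp|[/asboolP fg /asboolP fh] x].
  by split; apply/asboolP => x; have := hyp x; rewrite /= le_min => /andP[].
by rewrite /= le_min fg fh.
Qed.

Lemma LC_joinP F G H : LC_le (LC_join F G) H = LC_le F H && LC_le G H.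
Proof.
apply/asboolP/andP => [hyp|[/asboolP fh /asboolP gh] x].
  by split; apply/asboolP => x; have := hyp x; rewrite /= ge_max => /andP[].
by rewrite /= ge_max fh gh.
Qed.

Lemma LC_le_add2l H F G : LC_le F G -> LC_le (H + F) (H + G).
Proof. by move=> /asboolP fg; apply/asboolP => x; apply: lerD. Qed.

Lemma LC_le_scale r F G : 0 <= r -> LC_le F G -> LC_le (r *: F) (r *: G).
Proof.
by move=> r0 /asboolP fg; apply/asboolP => x; apply: ler_wpM2l.
Qed.

HB.instance Definition _ := Lmodule_isVectorLattice.Build R LC
  LC_le_refl LC_le_anti LC_le_trans LC_meetP LC_joinP LC_le_add2l LC_le_scale.
HB.instance Definition _ :=
  Order.Lattice.copy LC (VectorLattice.sort (LC : vectorLatticeType R)).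

Definition LC_one : LC := MkLC (lc_cst 1).

Lemma weak_unit_LC_one : weak_unit LC_one.
Proof.
split=> [|f f0]; first by apply/asboolP => x; apply: ler01.
apply/val_inj/funext => x /=.
have /(congr1 (fun h : LC => h x))/= := f0.
rewrite /Num.min; case: ifP => // _ /eqP; by rewrite oner_eq0.
Qed.

End LocallyConstant.

Definition boolean_space (X : topologicalType) : Prop :=
  [/\ compact [set: X], hausdorff_space X & totally_disconnected [set: X]].

Definition homeomorphic (X Y : topologicalType) : Prop :=
  exists (f : X -> Y) (g : Y -> X),
    [/\ cancel f g, cancel g f, continuous f & continuous g].

Definition totally_ordered (R : realType) (V : vectorLatticeType R) : Prop :=
  forall x y : V, (x <= y) || (y <= x).

Section Spectrum.
Variables (R : realType) (V : vectorLatticeType R) (u : V).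

Definition proper_ideal (K : ideal u) : Prop := exists a, ~ K a.

Definition prime_ideal (K : ideal u) : Prop :=
  proper_ideal K /\ totally_ordered (quot K).

Definition maximal_ideal (K : ideal u) : Prop :=
  [/\ proper_ideal K, totally_ordered (quot K) & archimedean (quot K)].

(* The ideal of [(V, u)] generated by [a]. *)
Definition principal (a : V) : set V :=
  [set b | forall K : ideal u, K a -> K b]%classic.

Record Spec := MkSpec { Spec_ideal :> ideal u; Spec_prime : prime_ideal Spec_ideal }.

HB.instance Definition _ := gen_eqMixin Spec.
HB.instance Definition _ := gen_choiceMixin Spec.

Definition Spec_basis_closed (P : set V) : set Spec :=
  [set p : Spec | P `<=` [set a | p a]]%classic.

Definition is_principal (P : set V) : Prop := exists a, P = principal a.

Lemma Spec_basis_closedP (a : V) (p : Spec) :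
  Spec_basis_closed (principal a) p <-> p a.
Proof. by split=> [h|pa b]; [apply: h|apply]. Qed.

Lemma Spec_basis_cover :
  (\bigcup_(P in [set P | is_principal P]) ~` Spec_basis_closed P = setT)%classic.
Proof.
apply/seteqP; split=> // p _; have [[a pa] _] := Spec_prime p.
by exists (principal a); [exists a|move/Spec_basis_closedP].
Qed.

Lemma Spec_basis_join (P Q : set V) (p : Spec) :
  is_principal P -> is_principal Q ->
  (~` Spec_basis_closed P)%classic p -> (~` Spec_basis_closed Q)%classic p ->
  exists S, [/\ is_principal S, (~` Spec_basis_closed S)%classic p &
    (~` Spec_basis_closed S `<=`
      ~` Spec_basis_closed P `&` ~` Spec_basis_closed Q)%classic].
Proof.
move=> [a ->] [b ->] pa pb; pose c : V := (absv a `&` absv b)%O.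
have c0 : 0 <= c by rewrite lexI !absv_ge0.
exists (principal c); split; first by exists c.
- move=> /Spec_basis_closedP pc.
  have [_ tot] := Spec_prime p.
  have inP (d e : V) : quot_pi p d <= quot_pi p e -> p (d `&` e)%O -> p d.
    move=> de pde; have := (quot_piP p (d `&` e)%O 0).2.
    rewrite subr0 => /(_ pde) eq0.
    move: de; rewrite leEmeet => /eqP.
    have [_ homI _] := quot_pi_vlhom p.
    by rewrite -homI eq0 => /esym/quot_piP; rewrite subr0.
  have /orP[ab|ba] := tot (quot_pi p (absv a)) (quot_pi p (absv b)).
    by apply: pa; apply/Spec_basis_closedP/vlideal_abs; apply: inP ab pc.
  apply: pb; apply/Spec_basis_closedP/vlideal_abs.
  by apply: inP ba _; rewrite meetC.
- move=> q qc; split=> /Spec_basis_closedP/vlideal_abs qx; apply: qc;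
    apply/Spec_basis_closedP;
    apply: (vlideal_convex (vlideal0 q) qx c0); [exact: leIl|exact: leIr].
Qed.

HB.instance Definition _ := isBaseTopological.Build Spec
  Spec_basis_cover Spec_basis_join.

(* A subset of a topological space, seen as a type, carries the subspace
   topology. *)
Definition MaxSpec : topologicalType :=
  set_type [set p : Spec | maximal_ideal p]%classic.

End Spectrum.

(* Main.v *)
Require Import Defs.
From mathcomp Require Import all_boot all_order all_algebra.
From mathcomp Require Import boolp classical_sets functions reals topology.

(** A vector lattice is hyperarchimedean iff for all [a, b >= 0] some [n] makes
    [a] disjoint from [(b - na)^+]. With [a := u] this makes [u] a strong unit;
    with [b := u] it makes [u - (u /\ na)] a component of [u] complementary to
    [a], so every basic open set of the prime spectrum is clopen. Every prime
    quotient is Archimedean and totally ordered, hence a copy of the real line,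
    and [v] becomes the locally constant function sending [p] to the real [r]
    with [v - ru] in [p]. This represents [V] faithfully on its prime spectrum,
    which is a Boolean space; compactness makes the representation onto.
    Conversely, the disjointness property holds in [LC X] because functions
    there take finitely many values, and every prime ideal of [LC X] consists of
    the functions vanishing at a point: by compactness its members have a common
    zero [x], and a function vanishing at [x] is disjoint from the indicator of
    its own zero set, which does not vanish at [x]. *)

Set Implicit Arguments.
Unset Strict Implicit.
Unset Printing Implicit Defensive.

Import Order.TTheory GRing.Theory Num.Theory.

Local Open Scope ring_scope.

(** * Meets, positive parts and disjointness in vector lattices *)

Section VectorLattices.
Variables (R : realType) (V : vectorLatticeType R).
Implicit Types (a b c x y z : V) (n m : nat).

Lemma addv_ge0 x y : 0 <= x -> 0 <= y -> 0 <= x + y.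
Proof. by move=> x0 y0; rewrite -[0]addr0; apply: lev_add. Qed.

Lemma mulvn_ge0 x n : 0 <= x -> 0 <= x *+ n.
Proof.
move=> x0; elim: n => [|n IHn]; first by rewrite mulr0n.
by rewrite mulrS; apply: addv_ge0.
Qed.

Lemma lev_mulrn x y n : x <= y -> x *+ n <= y *+ n.
Proof.
move=> xy; elim: n => [|n IHn]; first by rewrite !mulr0n.
by rewrite !mulrS; apply: lev_add.
Qed.

Lemma lev_wmulrn x n m : 0 <= x -> (n <= m)%N -> x *+ n <= x *+ m.
Proof.
move=> x0 /subnK <-; rewrite mulrnDr -[X in X <= _]add0r lev_add2rE.
exact: mulvn_ge0.
Qed.

Lemma subv_ge0 x y : (0 <= y - x) = (x <= y).
Proof. by rewrite -(lev_add2rE x 0) add0r subrK. Qed.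

Lemma lev_scalel (r s : R) x : 0 <= x -> r <= s -> r *: x <= s *: x.
Proof.
move=> x0 rs.
by rewrite -subv_ge0 -scalerBl -(scaler0 _ (s - r)) lev_scale ?subr_ge0.
Qed.

Lemma meetv_ge0 a b : 0 <= a -> 0 <= b -> 0 <= (a `&` b)%O.
Proof. by move=> a0 b0; rewrite lexI a0. Qed.

(** By translation the right side is the meet of [(a /\ b) + a], [c + a] and [c + b]; each lies
    above [a] or above [b + c]. *)
Lemma meetv_addr a b c : 0 <= a -> 0 <= b -> 0 <= c ->
  (a `&` (b + c))%O <= (a `&` b)%O + (a `&` c)%O.
Proof.
move=> a0 b0 c0; rewrite addv_meet lexI; apply/andP; split.
  apply: le_trans (leIl _ _) _; rewrite -[X in X <= _]add0r lev_add2rE.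
  exact: meetv_ge0.
rewrite [X in _ <= X]addrC addv_meet lexI; apply/andP; split.
  by apply: le_trans (leIl _ _) _; rewrite -[X in X <= _]add0r lev_add2rE.
by rewrite [c + b]addrC leIr.
Qed.

Lemma meetv_mulrn a b n : 0 <= a -> 0 <= b ->
  (a `&` (b *+ n))%O <= (a `&` b)%O *+ n.
Proof.
move=> a0 b0; elim: n => [|n IHn]; first by rewrite !mulr0n leIr.
rewrite !mulrS; apply: le_trans (meetv_addr _ _ _) _ => //.
  exact: mulvn_ge0.
by rewrite lev_add2lE.
Qed.

Lemma disjointv_mulrn a b n : 0 <= a -> 0 <= b -> (a `&` b)%O = 0 ->
  (a `&` (b *+ n))%O = 0.
Proof.
move=> a0 b0 ab0; apply/eqP.
rewrite eq_le (meetv_ge0 _ (mulvn_ge0 _ _))// andbT.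
by rewrite (le_trans (meetv_mulrn _ _ _))// ab0 mul0rn.
Qed.

Definition posv x : V := (x `|` 0)%O.

Lemma posv_ge0 x : 0 <= posv x. Proof. exact: leUr. Qed.
Lemma lev_posv x : x <= posv x. Proof. exact: leUl. Qed.

Lemma posv_id x : 0 <= x -> posv x = x.
Proof. by move=> x0; apply/eqP; rewrite eq_le lev_posv leUx lexx x0. Qed.

Lemma posvE x : posv x = - ((- x) `&` 0)%O.
Proof. by rewrite oppv_meet opprK oppr0. Qed.

Lemma posvB x : posv x - posv (- x) = x.
Proof.
rewrite [posv (- x)]posvE opprK opprK [X in X + _]posvE.
by apply/eqP; rewrite addrC subr_eq addv_meet addr0 subrr meetC.
Qed.

(** The two parts are the translates of [x] and [0] by [posv (- x)], and [x /\ 0] is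
    [- posv (- x)]. *)
Lemma disjointv_pos_neg x : (posv x `&` posv (- x))%O = 0.
Proof.
have e : posv (- x) + x = posv x.
  by rewrite -[X in _ + X = _](posvB x) addrC subrK.
rewrite -e -[X in (_ `&` X)%O]addr0 -addv_meet.
by rewrite [posv (- x)]posvE opprK addNr.
Qed.

(** Splits [b] into a part below [a] and the excess over [a]; an ideal containing both contains
    [b]. *)
Lemma addv_meet_posB a b : (a `&` b)%O + posv (b - a) = b.
Proof.
by rewrite posvE opprB; apply/eqP; rewrite subr_eq addv_meet addrC addr0 subrK.
Qed.

Lemma absv_eq0 x : absv x = 0 -> x = 0.
Proof.
move=> x0; apply/eqP; rewrite eq_le -{1}x0 lev_abs /=.
by have := lev_Nabs x; rewrite x0 oppr0.
Qed.

End VectorLattices.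

(** * Homomorphisms of vector lattices *)

Section Homomorphisms.
Variables (R : realType) (V W : vectorLatticeType R) (f : V -> W).
Hypothesis fh : is_vlhom f.

Lemma vlhomD x y : f (x + y) = f x + f y.
Proof. by case: fh => lin _ _; rewrite -[x]scale1r lin !scale1r. Qed.

Lemma vlhom0 : f 0 = 0.
Proof. by apply/(addIr (f 0)); rewrite -vlhomD !add0r. Qed.

Lemma vlhomZ r x : f (r *: x) = r *: f x.
Proof. by case: fh => lin _ _; rewrite -[r *: x]addr0 lin vlhom0 addr0. Qed.

Lemma vlhomN x : f (- x) = - f x.
Proof. by rewrite -scaleN1r vlhomZ scaleN1r. Qed.

Lemma vlhomB x y : f (x - y) = f x - f y.
Proof. by rewrite vlhomD vlhomN. Qed.

Lemma vlhomMn x n : f (x *+ n) = f x *+ n.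
Proof. by rewrite -!scaler_nat vlhomZ. Qed.

Lemma vlhomI x y : f (x `&` y)%O = (f x `&` f y)%O.
Proof. by case: fh. Qed.

Lemma vlhomU x y : f (x `|` y)%O = (f x `|` f y)%O.
Proof. by case: fh. Qed.

Lemma vlhom_pos x : f (posv x) = posv (f x).
Proof. by rewrite vlhomU vlhom0. Qed.

Lemma vlhom_le x y : x <= y -> f x <= f y.
Proof. by rewrite !leEmeet -vlhomI => /eqP ->. Qed.

End Homomorphisms.

(** The inverse comes from choice; each identity for it is checked after applying the injective
    [f]. *)
Lemma uvl_isomorphic_bij (R : realType) (V W : vectorLatticeType R)
    (u : V) (u' : W) (f : V -> W) :
  is_uvlhom u u' f -> (forall x, f x = 0 -> x = 0) ->
  (forall y, exists x, f x = y) -> uvl_isomorphic u u'.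
Proof.
move=> [fh fu] f0 /choice[g gK].
have finj : injective f.
  by move=> x y fxy; apply/eqP; rewrite -subr_eq0; apply/eqP/f0;
    rewrite (vlhomB fh) fxy subrr.
exists f, g; split=> //; last by move=> x; apply: finj; rewrite gK.
split; last by apply: finj; rewrite gK fu.
split=> [r x y|x y|x y]; apply: finj.
- by rewrite (vlhomD fh) (vlhomZ fh) !gK.
- by rewrite (vlhomI fh) !gK.
- by rewrite (vlhomU fh) !gK.
Qed.

(** * Quotient order, totally ordered quotients and generated ideals *)

Section Ideals.
Variables (R : realType) (V : vectorLatticeType R).
Implicit Types (K : vlideal V) (a b x y : V).

Lemma quot_pi0P K x : quot_pi K x = 0 <-> K x.
Proof.
rewrite -(vlhom0 (quot_pi_vlhom K)).
by split=> [/quot_piP|Kx]; [rewrite subr0|apply/quot_piP; rewrite subr0].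
Qed.

(** Order in the quotient means [x /\ y = x] modulo [K], and [x /\ y] differs from [x] by
    [- posv (x - y)]. *)
Lemma quot_pi_le K x y : (quot_pi K x <= quot_pi K y) <-> K (posv (x - y)).
Proof.
have e : (x `&` y)%O - x = - posv (x - y).
  by rewrite posvE opprK opprB addrC addv_meet addNr meetC addrC.
rewrite leEmeet -(vlhomI (quot_pi_vlhom K)).
split=> [/eqP/quot_piP|Kxy]; rewrite ?e.
  by move/vlidealN; rewrite opprK.
by apply/eqP/quot_piP; rewrite e; apply: vlidealN.
Qed.

(** In a totally ordered quotient the meet of two classes is one of them. *)
Lemma vlideal_prime K a b : totally_ordered (quot K) ->
  K (a `&` b)%O -> K a \/ K b.
Proof.
move=> tot /quot_pi0P; rewrite (vlhomI (quot_pi_vlhom K)) => ab0.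
case/orP: (tot (quot_pi K a) (quot_pi K b)) => /meet_l.
  by rewrite ab0 => /esym/quot_pi0P; left.
by rewrite meetC ab0 => /esym/quot_pi0P; right.
Qed.

Lemma totally_ordered_quot K :
  (forall x, K (posv x) \/ K (posv (- x))) -> totally_ordered (quot K).
Proof.
move=> h; elim/quot_piW => x; elim/quot_piW => y.
case: (h (x - y)) => [Kxy|]; first by apply/orP; left; apply/quot_pi_le.
by rewrite opprB => Kyx; apply/orP; right; apply/quot_pi_le.
Qed.

Lemma vlideal_le K a b : 0 <= a -> a <= b -> K b -> K a.
Proof. by move=> a0 ab Kb; apply: vlideal_convex (vlideal0 K) Kb a0 ab. Qed.

Section Generated.
Variable P : V -> Prop.
Hypothesis P0 : exists z, P z.
Hypothesis P_ge0 : forall z, P z -> 0 <= z.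
Hypothesis PD : forall x y, P x -> P y -> exists2 z, P z & x + y <= z.

(** The ideal is a symmetric order-convex hull. Sums only have to be dominated inside [P], so any
    convenient directed family of bounds can serve as [P]. *)
Definition gen_set x : Prop := exists2 z, P z & (- z <= x) && (x <= z).

Let gen_join a b : gen_set a -> gen_set b ->
  exists2 z, P z & [/\ - z <= a, a <= z, - z <= b & b <= z].
Proof.
move=> [x Px /andP[ax xa]] [y Py /andP[by_ yb]].
have [z Pz xyz] := PD Px Py; exists z => //.
have xz : x <= z.
  by apply: le_trans xyz; rewrite -[X in X <= _]addr0 lev_add2lE P_ge0.
have yz : y <= z.
  by apply: le_trans xyz; rewrite -[X in X <= _]add0r lev_add2rE P_ge0.
split; [|exact: le_trans xz| |exact: le_trans yz].
  by apply: le_trans ax; rewrite lev_opp2.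
by apply: le_trans by_; rewrite lev_opp2.
Qed.

Let gen0 : gen_set 0.
Proof.
by have [z Pz] := P0; exists z => //; rewrite -{1}oppr0 lev_opp2 P_ge0.
Qed.

Let genB a b : gen_set a -> gen_set b -> gen_set (a - b).
Proof.
move=> [x Px /andP[ax xa]] [y Py /andP[by_ yb]].
have [z Pz xyz] := PD Px Py; exists z => //; apply/andP; split.
  apply: (@le_trans _ _ (- x - y)); first by rewrite -opprD lev_opp2.
  by apply: lev_add => //; rewrite lev_opp2.
apply: le_trans xyz; apply: lev_add => //.
by rewrite -[y]opprK lev_opp2.
Qed.

Let genI a b : gen_set a -> gen_set b -> gen_set (a `&` b)%O.
Proof.
move=> Ga Gb; have [z Pz [za az zb bz]] := gen_join Ga Gb.
by exists z => //; rewrite lexI za zb leIxl.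
Qed.

Let genU a b : gen_set a -> gen_set b -> gen_set (a `|` b)%O.
Proof.
move=> Ga Gb; have [z Pz [za az zb bz]] := gen_join Ga Gb.
by exists z => //; rewrite leUx az bz lexUl.
Qed.

Let gen_convex a b c : gen_set a -> gen_set c -> a <= b -> b <= c -> gen_set b.
Proof.
move=> Ga Gc ab bc; have [z Pz [za _ _ cz]] := gen_join Ga Gc.
by exists z => //; rewrite (le_trans za)// (le_trans bc).
Qed.

Definition gen_vlideal := VLIdeal gen0 genB genI genU gen_convex.

Lemma gen_vlideal_sub z : P z -> gen_vlideal z.
Proof.
move=> Pz; have z0 := P_ge0 Pz; exists z => //; rewrite lexx andbT.
by apply: le_trans z0; rewrite -oppr0 lev_opp2 P_ge0.
Qed.

End Generated.
End Ideals.

(* Equivalently [na /\ b = (n + 1)a /\ b], i.e. [na /\ b] becomes stationary. *)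
Definition stabilizing (R : realType) (V : vectorLatticeType R) : Prop :=
  forall a b : V, 0 <= a -> 0 <= b ->
  exists n, (a `&` posv (b - a *+ n))%O = 0.

(** * Stabilization, strong units and existence of primes *)

Section Hyperarchimedean.
Variables (R : realType) (V : vectorLatticeType R).
Implicit Types (a b x y : V).

(* In the quotient by the ideal generated by the elements [(na - b)^+], every
   multiple of [a] is below [b]; hence [a] itself lies in this ideal. *)
Lemma hyperarchimedean_stabilizing : hyperarchimedean V -> stabilizing V.
Proof.
move=> hyp a b a0 b0.
pose P z := exists m n, z = posv (a *+ n - b) *+ m.
have P0 : exists z, P z by exists 0, 0%N, 0%N; rewrite mulr0n.
have P_ge0 z : P z -> 0 <= z by move=> [m [n ->]]; rewrite mulvn_ge0// posv_ge0.
have PD x y : P x -> P y -> exists2 z, P z & x + y <= z.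
  move=> [m [n ->]] [m' [n' ->]]; pose k := maxn n n'.
  exists (posv (a *+ k - b) *+ (m + m')); first by exists (m + m')%N, k.
  have mono i : (i <= k)%N -> posv (a *+ i - b) <= posv (a *+ k - b).
    move=> ik; rewrite leUx posv_ge0 andbT; apply: le_trans (lev_posv _).
    by rewrite lev_add2rE lev_wmulrn.
  by rewrite mulrnDr lev_add// lev_mulrn// mono// (leq_maxl, leq_maxr).
pose K := gen_vlideal P0 P_ge0 PD.
have Kn n : K (posv (a *+ n - b)).
  by apply: gen_vlideal_sub; exists 1%N, n; rewrite mulr1n.
have arch : archimedean (quot K).
  apply: (hyp _ (quot_pi K)); first exact: quot_pi_vlhom.
  by move=> w; exists (quot_repr w); apply: quot_reprK.
(* Membership in [K] bounds [a] by a multiple of some [(na - b)^+], which is disjoint from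
   [(b - na)^+]; this [n] works. *)
have [Ka|nKa] := pselect (K a).
  have [_ [m [n ->]] /andP[_ am]] := Ka.
  exists n; apply/eqP; rewrite eq_le meetv_ge0 ?posv_ge0 // andbT.
  have := disjointv_mulrn m (posv_ge0 _) (posv_ge0 _)
    (disjointv_pos_neg (b - a *+ n)).
  rewrite opprB => <-; rewrite lexI leIr /=.
  by apply: le_trans am; rewrite leIl.
have pia : 0 < quot_pi K a.
  rewrite lt_def; apply/andP; split; first by apply/eqP => /quot_pi0P.
  rewrite -(vlhom0 (quot_pi_vlhom K)).
  by apply: vlhom_le => //; apply: quot_pi_vlhom.
have [|n _ /negP[]] := arch _ (quot_pi K b) pia.
  by apply/quot_pi_le; have := Kn 1%N; rewrite mulr1n.
by rewrite -(vlhomMn (quot_pi_vlhom K)); apply/quot_pi_le.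
Qed.

(** If every [nv] stays below [w], lift both to nonnegative elements. The image of the disjointness
    relation says [v /\ (w - nv)^+ = 0], yet [v <= w - nv] because [(n + 1)v <= w]; so [v = 0]. *)
Lemma stabilizing_hyperarchimedean : stabilizing V -> hyperarchimedean V.
Proof.
move=> stab W f fh fsurj v w v0 vw.
apply: contrapT => /forall2NP big.
have vn n : (0 < n)%N -> v *+ n <= w.
  by move=> n0; have [//|/negP] := big n; rewrite negbK.
have [a' fa] := fsurj v; have [b' fb] := fsurj w.
have {}fa : f (posv a') = v by rewrite (vlhom_pos fh) fa posv_id// ltW.
have {}fb : f (posv b') = w.
  by rewrite (vlhom_pos fh) fb posv_id// (le_trans (ltW v0)).
have [n] := stab _ _ (posv_ge0 a') (posv_ge0 b').
move/(congr1 f); rewrite (vlhomI fh) fa (vlhom_pos fh) (vlhomB fh) (vlhomMn fh).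
rewrite (vlhom0 fh) fa fb meet_l => [v00|].
  by move: v0; rewrite v00 ltxx.
apply: le_trans (lev_posv _).
by rewrite -(lev_add2rE (v *+ n)) subrK -mulrS vn.
Qed.

(** The excess of [posv x] over some [nu] is disjoint from [u], hence zero by weakness of the
    unit. *)
Lemma stabilizing_strong_unit (u : V) : weak_unit u -> stabilizing V ->
  forall x, exists n, x <= u *+ n.
Proof.
move=> [u0 wu] stab x; have [n /wu pn] := stab _ _ u0 (posv_ge0 x).
exists n; apply: le_trans (lev_posv x) _.
by rewrite -(lev_add2rE (- (u *+ n))) subrr -pn lev_posv.
Qed.

(** Zorn's lemma on the ideals missing [a]. If a maximal one contained neither [posv x] nor
    [posv (- x)], adjoining each in turn would bound [a] by two disjoint multiples modulo [K], so
    [a] would lie in [K]. *)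
Lemma exists_prime_vlideal a : 0 < a ->
  exists K : vlideal V, ~ K a /\ totally_ordered (quot K).
Proof.
move=> a0.
pose T := {K : vlideal V | ~ K a}.
pose mk K nKa : T := exist (fun K : vlideal V => ~ K a) K nKa.
pose le (K L : T) : bool := `[< forall x, sval K x -> sval L x >].
have z0 : exists z : V, z = 0 by exists 0.
have z_ge0 (z : V) : z = 0 -> 0 <= z by move=> ->.
have zD (x y : V) : x = 0 -> y = 0 -> exists2 z : V, z = 0 & x + y <= z.
  by move=> -> ->; exists 0 => //; rewrite addr0.
have zero_a : ~ gen_vlideal z0 z_ge0 zD a.
  by move=> [z -> /andP[_ /(lt_le_trans a0)]]; rewrite ltxx.
have [||A Atot|[K nKa] Kmax] := @ZL_preorder T (mk _ zero_a) le.
- by move=> K; apply/asboolP.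
- by move=> L K M /asboolP LK /asboolP KM; apply/asboolP => x /LK/KM.
(* A nonempty chain is bounded by its union, the empty one by the zero ideal. *)
- have [[L0 AL0]|A0] := pselect (exists L, A L); last first.
    by exists (mk _ zero_a) => L AL; case: A0; exists L.
  pose U x := exists2 L, A L & sval L x.
  have U2 x y : U x -> U y -> exists L, [/\ A L, sval L x & sval L y].
    move=> [L AL Lx] [M AM My]; case: (Atot _ _ AL AM) => /asboolP h.
      by exists M; split=> //; apply: h.
    by exists L; split=> //; apply: h.
  have U0 : U 0 by exists L0 => //; apply: vlideal0.
  have UB x y : U x -> U y -> U (x - y).
    by move=> Ux Uy; have [L [AL Lx Ly]] := U2 _ _ Ux Uy;
      exists L => //; apply: vlidealB.
  have UI x y : U x -> U y -> U (x `&` y)%O.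
    by move=> Ux Uy; have [L [AL Lx Ly]] := U2 _ _ Ux Uy;
      exists L => //; apply: vlidealI.
  have UU x y : U x -> U y -> U (x `|` y)%O.
    by move=> Ux Uy; have [L [AL Lx Ly]] := U2 _ _ Ux Uy;
      exists L => //; apply: vlidealU.
  have Uc x y z : U x -> U z -> x <= y -> y <= z -> U y.
    move=> Ux Uz xy yz; have [L [AL Lx Lz]] := U2 _ _ Ux Uz.
    by exists L => //; apply: vlideal_convex Lx Lz xy yz.
  have nUa : ~ VLIdeal U0 UB UI UU Uc a by move=> [L _]; apply: (svalP L).
  by exists (mk _ nUa) => L AL; apply/asboolP => x Lx; exists L.
exists K; split=> //; apply: totally_ordered_quot => x.
(* By maximality of [K], an ideal containing [K] and a new [y] contains [a]. *)
have key y : 0 <= y -> K y \/ exists k n, [/\ K k, 0 <= k & a <= k + y *+ n].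
  move=> y0; pose P z := exists k n, [/\ K k, 0 <= k & z = k + y *+ n].
  have P0 : exists z, P z.
    by exists 0, 0, 0%N; rewrite mulr0n addr0; split=> //; apply: vlideal0.
  have P_ge0 z : P z -> 0 <= z.
    by move=> [k [n [_ k0 ->]]]; apply: addv_ge0 => //; apply: mulvn_ge0.
  have PD w z : P w -> P z -> exists2 t, P t & w + z <= t.
    move=> [k [n [Kk k0 ->]]] [k' [n' [Kk' k0' ->]]].
    exists (k + k' + y *+ (n + n')); last by rewrite mulrnDr addrACA.
    by exists (k + k'), (n + n')%N; split=> //;
      [apply: vlidealD|apply: addv_ge0].
  have [[_ [k [n [Kk k0 ->]]] /andP[_ an]]|nLa] :=
      pselect (gen_vlideal P0 P_ge0 PD a).
    by right; exists k, n.
  left; have KL : le (mk _ nKa) (mk _ nLa).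
    apply/asboolP => k Kk; apply/vlideal_abs/gen_vlideal_sub.
    exists (absv k), 0%N; rewrite mulr0n addr0 absv_ge0; split=> //.
    exact/vlideal_abs.
  have /asboolP := Kmax _ KL; apply.
  apply: gen_vlideal_sub; exists 0, 1%N; rewrite add0r mulr1n.
  by split=> //; apply: vlideal0.
case: (key _ (posv_ge0 x)) => [|[k [n [Kk k0 an]]]]; first by left.
case: (key _ (posv_ge0 (- x))) => [|[k' [n' [Kk' k0' an']]]]; first by right.
exfalso; apply: (nKa); apply: (vlideal_le (ltW a0) _ (vlidealD Kk Kk')).
have dis : (posv x *+ n `&` posv (- x) *+ n')%O = 0.
  apply: disjointv_mulrn; rewrite ?mulvn_ge0 ?posv_ge0// meetC.
  apply: disjointv_mulrn; rewrite ?posv_ge0// meetC.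
  exact: disjointv_pos_neg.
(* Both bounds on [a] are enlarged to start from [k + k']; their meet is then [k + k'] by
   disjointness. *)
rewrite -[k + k']addr0 -dis addv_meet lexI; apply/andP; split.
  by apply: le_trans an _; rewrite lev_add2rE -[X in X <= _]addr0 lev_add2lE.
by apply: le_trans an' _; rewrite lev_add2rE -[X in X <= _]add0r lev_add2rE.
Qed.

End Hyperarchimedean.

(** A Dedekind cut: the coefficient is the supremum [s] of the reals whose multiple of [u] is below
    [x]. Totality puts [x] within [e u] of [s u] for all [e > 0], and the Archimedean property
    closes the gap. *)
Lemma totally_ordered_archimedean_line (R : realType) (W : vectorLatticeType R)
    (u : W) : totally_ordered W -> archimedean W -> 0 < u ->
  (forall x, exists n, x <= u *+ n) -> forall x, exists r : R, x = r *: u.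
Proof.
move=> tot arch u0 strong x.
have scal_inj r s : r *: u <= s *: u -> r <= s.
  move=> rs; rewrite leNgt; apply/negP => sr.
  have : (r - s)^-1 *: (r *: u) <= (r - s)^-1 *: (s *: u).
    by apply: lev_scale => //; rewrite invr_ge0 subr_ge0 ltW.
  rewrite -subv_ge0 -scalerBr -scalerBl scalerA -[s - r]opprB mulrN mulVf.
    by rewrite scaleN1r -oppr0 lev_opp2 => /(lt_le_trans u0); rewrite ltxx.
  by rewrite subr_eq0 gt_eqF.
pose S : set R := [set r | r *: u <= x]%classic.
have [n xn] := strong x; have [m xm] := strong (- x).
have S0 : (S !=set0)%classic.
  by exists (- m%:R); rewrite /S /= scaleNr scaler_nat -lev_opp2 opprK.
have Sub : has_ubound S.
  by exists n%:R => r Sr; apply: scal_inj; rewrite scaler_nat (le_trans Sr).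
pose s := sup S; exists s.
have below e : 0 < e -> (s - e) *: u <= x.
  move=> e0; have [r Sr sr] := sup_adherent e0 (conj S0 Sub).
  by apply: le_trans Sr; apply: lev_scalel; rewrite ltW.
have above e : 0 < e -> x <= (s + e) *: u.
  move=> e0; have /orP[//|Se] := tot x ((s + e) *: u).
  by have := ub_le_sup Sub Se; rewrite gerDl leNgt e0.
have small e : 0 < e -> absv (x - s *: u) <= e *: u.
  move=> e0; rewrite leUx; apply/andP; split.
    by rewrite -(lev_add2rE (s *: u)) subrK addrC -scalerDl above.
  rewrite opprB -(lev_add2rE (x - e *: u)) addrA subrK addrCA subrr addr0.
  by rewrite -scalerBl below.
have := absv_ge0 (x - s *: u); rewrite le_eqVlt => /orP[/eqP/esym/absv_eq0|d0].
  by move/eqP; rewrite subr_eq0 => /eqP.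
have := small 1 ltr01; rewrite scale1r => du.
have [k k0 /negP[]] := arch _ _ d0 du.
have k0' : 0 < k%:R :> R by rewrite ltr0n.
(* Scaling the estimate for [e = 1/k] by [k] contradicts the choice of [k]. *)
have := lev_scale (ltW k0') (small k%:R^-1 _).
by rewrite scaler_nat scalerA mulfV ?gt_eqF// scale1r; apply; rewrite invr_gt0.
Qed.

(** * Compactness and clopen sets in Boolean spaces *)

Section BooleanSpaces.
Local Open Scope classical_set_scope.
Variable X : topologicalType.

(** If [P] fails on the whole space, the sets whose complement satisfies [P] form a proper filter.
    It has a cluster point, but the complement of a neighbourhood satisfying [P] belongs to the
    filter. *)
Lemma compact_local_induction (P : set X -> Prop) :
  compact [set: X] -> P set0 ->
  (forall A B, A `<=` B -> P B -> P A) ->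
  (forall A B, P A -> P B -> P (A `|` B)) ->
  (forall x, exists2 U, open_nbhs x U & P U) -> P setT.
Proof.
move=> cX P0 PS PU Ploc; apply: contrapT => nPT.
pose F : set_system X := [set A | P (~` A)].
have FF : ProperFilter F.
  split=> [|]; first by rewrite /F /= setC0.
  split; first by rewrite /F /= setCT.
    by move=> A B FA FB; rewrite /F /= setCI; apply: PU.
  by move=> A B AB; apply: PS => x; apply: contra_not => /AB.
have [x [_ xF]] : setT `&` cluster F !=set0 by apply: cX => //; apply: filterT.
have [U /open_nbhs_nbhs xU PU'] := Ploc x.
by have [||y []] := xF (~` U) U; rewrite /F /= ?setCK.
Qed.

Lemma compact_hausdorff_separate (A B : set X) :
  hausdorff_space X -> compact [set: X] -> closed A -> closed B ->
  A `&` B = set0 ->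
  exists U V, [/\ open U, open V, A `<=` U, B `<=` V & U `&` V = set0].
Proof.
move=> hX cX cA cB AB0; have nX := compact_normal hX cX.
have [|W /set_nbhsP[U [oU AU UW]] WB] := nX A cA (~` B).
  apply/set_nbhsP; exists (~` B); split=> //; first exact: closed_openC.
  by apply/disjoints_subset.
exists U, (~` closure W); split=> //.
- exact/closed_openC/closed_closure.
- by move=> y By /WB.
- by apply/disjoints_subset => y /UW /subset_closure; rewrite setCK.
Qed.

(* In a compact Hausdorff space the intersection of all clopen neighbourhoods
   of a point is connected. *)
Lemma compact_totally_disconnected_zero_dimensional :
  boolean_space X -> zero_dimensional X.
Proof.
move=> [cX hX tdX] x y; apply: contra_neqP => nsep.
pose Q : set X := \bigcap_(C in [set C | clopen C /\ C x]) C.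
have Qx : Q x by move=> C [].
have cQ : closed Q by apply: closed_bigI => C [[]].
(* Separate [A] and [B] by open [U] and [V]. By compactness some clopen [C] around [x] lies in their
   union; then the part of [C] in [U] is clopen and contains [Q], which leaves nothing for [B]. *)
have key (A B : set X) : closed A -> closed B -> Q = A `|` B ->
    A `&` B = set0 -> A x -> B = set0.
  move=> cA cB QAB AB0 Ax.
  have [U [V [oU oV AU BV UV0]]] := compact_hausdorff_separate hX cX cA cB AB0.
  pose P (S : set X) := exists C, [/\ clopen C, C x & C `&` S `<=` U `|` V].
  have [|S T ST|S T|z|C [[oC cC] Cx]] := @compact_local_induction P cX.
  - by exists setT; rewrite setI0; split=> //; exact: clopenT.
  - by move=> [C [? ? CT]]; exists C; split=> // z [Cz /ST Tz]; apply: CT.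
  - move=> [C [cC Cx CS]] [D [cD Dx DT]]; exists (C `&` D).
    split=> //; first exact: clopenI.
    by move=> z [[Cz Dz] [Sz|Tz]]; [apply: CS|apply: DT].
  - have [Qz|nQz] := pselect (Q z).
      exists (U `|` V).
        split; first exact: openU.
        by move: Qz; rewrite QAB => -[/AU|/BV]; [left|right].
      by exists setT; rewrite setTI; split=> //; exact: clopenT.
    have [C] : exists C, ~ (clopen C /\ C x -> C z).
      by apply/existsNP => h; apply: nQz => C; apply: h.
    move=> /not_implyP[[[oC cC] Cx] nCz]; exists (~` C).
      by split=> //; apply: closed_openC.
    by exists C; rewrite setICr; split.
  rewrite setIT => CUV.
  have cCU : clopen (C `&` U).
    split; first exact: openI.
    have -> : C `&` U = C `&` ~` V.
      apply/seteqP; split=> z [Cz].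
        by move=> Uz; split=> // Vz; have : (U `&` V) z by []; rewrite UV0.
      by move=> nVz; split=> //; case: (CUV _ Cz).
    by apply: closedI => //; apply: open_closedC.
  apply/seteqP; split=> // z Bz.
  have Qz : Q z by rewrite QAB; right.
  have [_ Uz] : (C `&` U) z by apply: Qz; split=> //; split=> //; apply: AU.
  by have : (U `&` V) z; [split=> //; apply: BV|rewrite UV0].
have conQ : connected Q.
  move=> B B0 [C oC BC] [D cD BD].
  (* A relatively clopen [B] and its complement in [Q] are both closed, so the one without [x] is
     empty. *)
  have cB : closed B by rewrite BD; apply: closedI.
  have cB' : closed (Q `&` ~` C) by apply: closedI => //; apply: open_closedC.
  have QE : Q = B `|` (Q `&` ~` C) by rewrite BC -setIUr setUCr setIT.
  have BB' : B `&` (Q `&` ~` C) = set0.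
    by rewrite BC setIACA setICr setI0.
  have [Bx|B'x] : (B `|` (Q `&` ~` C)) x by rewrite -QE.
    by rewrite [RHS]QE (key _ _ cB cB' QE BB' Bx) setU0.
  have B00 : B = set0.
    by apply: (key _ _ cB' cB) => //; [rewrite setUC|rewrite setIC].
  by case: B0 => z; rewrite B00.
have Qy : Q y.
  move=> C [cC Cx]; apply: contrapT => nCy; apply: nsep.
  by exists C.
by have : connected_component setT x y; [exists Q|rewrite tdX].
Qed.

Lemma clopen_nbhs_basis (x : X) (U : set X) : boolean_space X ->
  open_nbhs x U -> exists C, [/\ clopen C, C x & C `<=` U].
Proof.
move=> bX [oU Ux]; have zX := compact_totally_disconnected_zero_dimensional bX.
case: bX => cX hX _.
have := zero_dimensional_cvg hX zX cX (open_nbhs_nbhs (conj oU Ux)).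
by move=> [C [Cx clC] CU]; exists C.
Qed.

End BooleanSpaces.

Lemma homeomorphic_sym (X Y : topologicalType) :
  homeomorphic X Y -> homeomorphic Y X.
Proof. by move=> [f [g [fK gK cf cg]]]; exists g, f. Qed.

Lemma homeomorphic_trans (X Y Z : topologicalType) :
  homeomorphic X Y -> homeomorphic Y Z -> homeomorphic X Z.
Proof.
move=> [f [g [fK gK cf cg]]] [h [k [hK kK ch ck]]].
exists (h \o f), (g \o k); split.
- exact: can_comp hK fK.
- exact: can_comp gK kK.
- by move=> x; apply: continuous_comp; [apply: cf|apply: ch].
- by move=> x; apply: continuous_comp; [apply: ck|apply: cg].
Qed.

(** * Locally constant functions on compact spaces *)

Section LocallyConstantFunctions.
Local Open Scope classical_set_scope.
Variables (R : realType) (X : topologicalType).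
Implicit Types f g h : LC X R.

Lemma LC_eqP f g : (forall x, f x = g x) -> f = g.
Proof. by move=> fg; apply/val_inj/funext. Qed.

Lemma LC_leP f g : (f <= g) <-> (forall x, f x <= g x).
Proof. by split=> [/asboolP|fg]; last apply/asboolP. Qed.

Lemma LC_locally f x : exists2 U, open_nbhs x U & forall y, U y -> f y = f x.
Proof. by have /lc_predP := LC_funP f; apply. Qed.

Lemma LC_mulrnE f n x : (f *+ n) x = f x *+ n.
Proof. by elim: n => [|n IHn]; rewrite ?mulr0n// !mulrS -IHn. Qed.

Lemma indicator_locally_constant (C : set X) : clopen C ->
  (fun x => (`[< C x >])%:R : R) \in @lc_pred X R.
Proof.
move=> [oC cC]; apply/lc_predP => x; have [Cx|nCx] := pselect (C x).
  by exists C => // y Cy; rewrite !asboolT.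
exists (~` C); first by split=> //; apply: closed_openC.
by move=> y nCy; rewrite !asboolF.
Qed.

Definition LC_indicator (C : set X) (clC : clopen C) : LC X R :=
  MkLC (indicator_locally_constant clC).

(** Preimages of arbitrary sets are open by local constancy, in particular that of the complement of
    [A]. *)
Lemma clopen_LC_preimage f (A : set R) : clopen [set x | A (f x)].
Proof.
have op (B : set R) : open [set x | B (f x)].
  rewrite openE => x Bx; have [U xU fU] := LC_locally f x.
  by apply: filterS (open_nbhs_nbhs xU) => y /fU /= ->.
split; first exact: op.
by rewrite -[X in closed X]setCK; apply: open_closedC; apply: (op (~` A)).
Qed.

(** Near each point [a] and [b] are constant, so either [a] vanishes or some [n] gives [b <= na];
    compactness makes [n] uniform by taking maxima. *)
Lemma compact_stabilizing_LC : compact [set: X] -> stabilizing (LC X R).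
Proof.
move=> cX a b /LC_leP a_ge0 /LC_leP b_ge0.
have a0 x : 0 <= a x :> R by apply: a_ge0.
have b0 x : 0 <= b x :> R by apply: b_ge0.
pose P (A : set X) := exists n : nat, forall x, A x ->
  a x = 0 \/ b x <= a x *+ n.
have [|A B AB|A B|x|n h] := @compact_local_induction X P cX.
- by exists 0%N.
- by move=> [n h]; exists n => x /AB/h.
- move=> [n hn] [m hm]; exists (maxn n m) => x ABx.
  have mono i : (i <= maxn n m)%N -> a x *+ i <= a x *+ maxn n m.
    move=> ik; rewrite -(mulr_natr _ i) -(mulr_natr _ (maxn n m)).
    by rewrite ler_wpM2l ?ler_nat.
  case: ABx => [/hn|/hm] [->|bx]; [by left| |by left|];
    by right; apply: le_trans bx _; apply: mono; rewrite (leq_maxl, leq_maxr).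
- have [U xU aU] := LC_locally a x; have [W xW bW] := LC_locally b x.
  exists (U `&` W); first exact: open_nbhsI.
  have [a00|an0] := eqVneq (a x) 0; first by exists 0%N => y [/aU -> _]; left.
  have ax : 0 < a x by rewrite lt_def an0 a0.
  exists (Num.bound (b x / a x)) => y [/aU -> /bW ->]; right.
  rewrite -mulr_natl -ler_pdivrMr// ltW// archi_boundP//.
  by rewrite divr_ge0 ?a0 ?b0.
exists n; apply: LC_eqP => x.
change (Num.min (a x) (Num.max ((b - a *+ n) x) 0) = 0).
have -> : (b - a *+ n) x = b x - a x *+ n by rewrite -LC_mulrnE.
have [->|bx] := h x I.
  by rewrite mul0rn subr0; apply/min_idPl; rewrite le_max lexx orbT.
rewrite max_r ?subr_le0//; apply/min_idPr; exact: a0.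
Qed.

End LocallyConstantFunctions.

(* A lattice form of the Stone-Weierstrass theorem: interpolate [f] at two
   points, hence near them, then glue by finite joins and finite meets. *)
Lemma LC_dense (R : realType) (X : topologicalType) (V : vectorLatticeType R)
    (u : V) (h : V -> LC X R) :
  compact [set: X] -> is_uvlhom u (LC_one X R) h ->
  (forall x y, x <> y -> exists v, h v x <> h v y) ->
  forall f, exists v, h v = f.
Proof.
Local Open Scope classical_set_scope.
move=> cX [hh hu] sep f.
have hue r x : h (r *: u) x = r.
  by rewrite (vlhomZ hh) hu; change (r * 1 = r); rewrite mulr1.
have hDe v w x : h (v + w) x = h v x + h w x by rewrite (vlhomD hh).
have hZe r v x : h (r *: v) x = r * h v x by rewrite (vlhomZ hh).
have interp x y : exists2 v, h v x = f x & h v y = f y.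
  have [->|xy] := pselect (x = y); first by exists (f y *: u); rewrite hue.
  have [v vxy] := sep _ _ xy.
  pose d := h v x - h v y.
  have d0 : d != 0 by rewrite subr_eq0; apply/eqP.
  (* Affine interpolation: [c] is the slope of [f] against [h v], and a multiple of [u] corrects the
     constant. *)
  pose c := (f x - f y) / d.
  exists (c *: v + (f x - c * h v x) *: u); rewrite hDe hZe hue.
    by rewrite addrC subrK.
  rewrite addrCA -mulrBr -[h v y - _]opprB -/d mulrN /c divfK// opprB.
  by rewrite addrC subrK.
have above x : exists2 v, h v x = f x & forall y, f y <= h v y.
  pose P (A : set X) := exists2 v, h v x = f x & forall y, A y -> f y <= h v y.
  have [|A B AB|A B|y|v vx vf] := @compact_local_induction X P cX.
  - by exists (f x *: u).
  - by move=> [v vx vf]; exists v => // y /AB/vf.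
  - move=> [v vx vf] [w wx wf]; exists (v `|` w)%O.
      rewrite (vlhomU hh); change (Num.max (h v x) (h w x) = f x).
      by rewrite vx wx maxxx.
    move=> y ABy; rewrite (vlhomU hh); change (f y <= Num.max (h v y) (h w y)).
    by rewrite le_max; case: ABy => [/vf ->//|/wf ->]; rewrite orbT.
  - have [v vx vy] := interp x y.
    have [U yU vU] := LC_locally (h v) y; have [W yW fW] := LC_locally f y.
    exists (U `&` W); first exact: open_nbhsI.
    by exists v => // z [/vU -> /fW ->]; rewrite vy.
  by exists v => // y; apply: vf.
pose P (A : set X) := exists2 v, (forall y, f y <= h v y) &
  forall y, A y -> h v y = f y.
have [|A B AB|A B|x|v _ vf] := @compact_local_induction X P cX.
(* Even the empty set requires some [v] above [f]: the one built at any point, or [0] when [X] is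
   empty. *)
- have [[x]|X0] := pselect (exists x : X, True).
    by have [v vx vf] := above x; exists v.
  by exists 0 => y; case: X0; exists y.
- by move=> [v vf ve]; exists v => // y /AB/ve.
- move=> [v vf ve] [w wf we].
  have mE y : h (v `&` w)%O y = Num.min (h v y) (h w y) by rewrite (vlhomI hh).
  exists (v `&` w)%O => y; rewrite mE; first by rewrite le_min vf wf.
  by move=> [/ve ->|/we ->]; [apply/min_idPl|apply/min_idPr].
- have [v vx vf] := above x.
  have [U yU vU] := LC_locally (h v) x; have [W yW fW] := LC_locally f x.
  exists (U `&` W); first exact: open_nbhsI.
  by exists v => // z [/vU -> /fW ->].
by exists v; apply: LC_eqP => x; apply: vf.
Qed.

(** * The prime spectrum and its compactness *)

Section SpectrumTopology.
Local Open Scope classical_set_scope.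
Variables (R : realType) (V : vectorLatticeType R) (u : V).
Implicit Types (p q : Spec u) (K : ideal u) (a b : V).

(** With [u] in [K], each [b >= 0] has [b /\ u] squeezed between [- absv u] and [absv u], so the
    unit condition puts [b] in [K]. *)
Lemma proper_ideal_unit K : Defs.proper_ideal K -> ~ K u.
Proof.
move=> [a nKa] Ku; apply: nKa; apply/vlideal_abs/ideal_unit.
  exact: absv_ge0.
have Ku' : K (absv u) by apply/vlideal_abs.
have Kb b : 0 <= b -> K b.
  move=> b0; apply: ideal_unit => //.
  apply: (vlideal_convex (vlidealN Ku') Ku').
    rewrite lexI lev_Nabs andbT; apply: le_trans b0.
    by rewrite -oppr0 lev_opp2 absv_ge0.
  exact: le_trans (leIr _ _) (lev_abs _).
by apply: vlidealI => //; apply: Kb; apply: absv_ge0.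
Qed.

Lemma Spec_unit p : ~ p u.
Proof. by apply: proper_ideal_unit; case: (Spec_prime p). Qed.

Lemma Spec_meet p a b : p (a `&` b)%O -> p a \/ p b.
Proof. by apply: vlideal_prime; case: (Spec_prime p). Qed.

(** Apart from the underlying set, all fields are proofs and hence irrelevant. *)
Lemma Spec_ext p q : (forall a, p a <-> q a) -> p = q.
Proof.
case: p q => [[[P p1 p2 p3 p4 p5] p6] p7] [[[Q q1 q2 q3 q4 q5] q6] q7] /= PQ.
have {}PQ : P = Q by apply/funext => a; apply/propext.
subst Q.
have ? := Prop_irrelevance p1 q1; subst q1.
have ? := Prop_irrelevance p2 q2; subst q2.
have ? := Prop_irrelevance p3 q3; subst q3.
have ? := Prop_irrelevance p4 q4; subst q4.
have ? := Prop_irrelevance p5 q5; subst q5.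
have ? := Prop_irrelevance p6 q6; subst q6.
by have -> := Prop_irrelevance p7 q7.
Qed.

Lemma Spec_nbhsP p (A : set (Spec u)) :
  nbhs p A <-> exists2 a, ~ p a & forall q, ~ q a -> A q.
Proof.
split=> [|[a npa aA]].
  rewrite nbhsE => -[B [[D DP <-] [P DPP pP]] BA].
  have [a Pa] := DP _ DPP; subst P.
  exists a => [pa|q nqa]; first by apply: pP; apply/Spec_basis_closedP.
  by apply: BA; exists (principal u a) => // /Spec_basis_closedP.
rewrite nbhsE; exists [set q : Spec u | ~ q a] => //; split=> //.
exists [set principal u a]; first by move=> _ ->; exists a.
apply/seteqP; split=> [q [_ -> h] qa|q nqa].
  by apply: h; apply/Spec_basis_closedP.
by exists (principal u a) => // /Spec_basis_closedP.
Qed.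

Lemma Spec_open a : open [set p : Spec u | ~ p a].
Proof. by rewrite openE => p npa; apply/Spec_nbhsP; exists a. Qed.

(** An ultrafilter [F] converges to the ideal of the elements lying in [F]-almost every [p]. This
    limit is prime because [F] decides whether [posv x] lies in [p], and if not then [posv (- x)]
    does. *)
Lemma Spec_compact : compact [set: Spec u].
Proof.
rewrite compact_ultra => F FU _.
pose U a := F [set p : Spec u | p a].
have U0 : U 0 by apply: filterS filterT => p _; apply: vlideal0.
have UB a b : U a -> U b -> U (a - b).
  by move=> Ua Ub; apply: filterS (filterI Ua Ub) => p [pa pb]; apply: vlidealB.
have UI a b : U a -> U b -> U (a `&` b)%O.
  by move=> Ua Ub; apply: filterS (filterI Ua Ub) => p [pa pb]; apply: vlidealI.
have UU a b : U a -> U b -> U (a `|` b)%O.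
  by move=> Ua Ub; apply: filterS (filterI Ua Ub) => p [pa pb]; apply: vlidealU.
have Uc a b c : U a -> U c -> a <= b -> b <= c -> U b.
  move=> Ua Uc ab bc; apply: filterS (filterI Ua Uc) => p [pa pc].
  exact: vlideal_convex pa pc ab bc.
pose K := VLIdeal U0 UB UI UU Uc.
have Uu a : 0 <= a -> K (a `&` u)%O -> K a.
  by move=> a0; apply: filterS => p; apply: ideal_unit.
pose I := Ideal Uu.
have prI : prime_ideal I.
  split.
    exists u => Ku; have [p pu] : exists p : Spec u, p u by apply: filter_ex Ku.
    exact: Spec_unit pu.
  apply: totally_ordered_quot => x.
  have [|nFx] := in_ultra_setVsetC [set p : Spec u | p (posv x)] FU.
    by left.
  right; apply: filterS nFx => p npx.
  have : p (posv x `&` posv (- x))%O.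
    by rewrite disjointv_pos_neg; apply: vlideal0.
  by move=> /Spec_meet[].
exists (MkSpec prI); split=> // A /Spec_nbhsP[a nKa aA].
have [//|Fa] := in_ultra_setVsetC [set p : Spec u | p a] FU.
exact: filterS Fa.
Qed.

End SpectrumTopology.

(** * Representation of a hyperarchimedean lattice on its spectrum *)

Section SpectrumOfHyperarchimedean.
Local Open Scope classical_set_scope.
Variables (R : realType) (V : vectorLatticeType R) (u : V).
Hypotheses (hu : weak_unit u) (hyp : hyperarchimedean V).
Implicit Types (p q : Spec u) (a b v w : V) (r s : R).

Let stab := hyperarchimedean_stabilizing hyp.
Let strong := stabilizing_strong_unit hu stab.
Let u_ge0 : 0 <= u. Proof. by case: hu. Qed.

(** Take [b = (u - n|a|)^+], with [n] making it disjoint from [|a|]. A prime contains one of the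
    two; containing both, it would contain [u], which is [b] plus an element below [n|a|]. *)
Lemma Spec_complement a : exists b, forall p, p a <-> ~ p b.
Proof.
have [n dis] := stab (absv_ge0 a) u_ge0.
exists (posv (u - absv a *+ n)) => p; split=> [pa pb|npb].
  apply: (@Spec_unit _ _ _ p).
  rewrite -[X in p X](addv_meet_posB (absv a *+ n)).
  apply: vlidealD => //; apply: (@vlideal_le _ _ _ _ (absv a *+ n)).
  - by rewrite meetv_ge0 ?mulvn_ge0 ?absv_ge0.
  - exact: leIl.
  - exact/vlidealMn/vlideal_abs.
have /Spec_meet[/vlideal_abs//|//] : p (absv a `&` posv (u - absv a *+ n))%O.
by rewrite dis; apply: vlideal0.
Qed.

Lemma Spec_clopen a : clopen [set p : Spec u | p a].
Proof.
have [b ab] := Spec_complement a; split.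
  rewrite (_ : mkset _ = [set p : Spec u | ~ p b]); first exact: Spec_open.
  by apply/seteqP; split=> p /ab.
by rewrite -[X in closed X]setCK; apply/open_closedC/Spec_open.
Qed.

Lemma Spec_zero_dimensional : zero_dimensional (Spec u).
Proof.
move=> p q; apply: contra_neqP => nsep; apply: Spec_ext => a.
split=> [pa|qa]; apply: contrapT => na; apply: nsep.
  by exists [set p : Spec u | p a]; split=> //; apply: Spec_clopen.
exists (~` [set p : Spec u | p a]); split=> //.
exact: (clopenC set0 (Spec_clopen a)).
Qed.

Lemma Spec_boolean : boolean_space (Spec u).
Proof.
split; first exact: Spec_compact.
  rewrite open_hausdorff => p q /Spec_zero_dimensional[U [[oU cU] Up nUq]].
  exists (U, ~` U); first by rewrite !inE.
  by split=> //=; [apply: closed_openC|rewrite setICr].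
exact/zero_dimension_totally_disconnected/Spec_zero_dimensional.
Qed.

Lemma Spec_value_ex p v : exists r, p (v - r *: u).
Proof.
have pih := quot_pi_vlhom p.
have [_ tot] := Spec_prime p.
have arch : archimedean (quot p).
  by apply: (hyp pih) => w; exists (quot_repr w); apply: quot_reprK.
have pu : 0 < quot_pi p u.
  rewrite lt_def -(vlhom0 pih) (vlhom_le pih)// andbT.
  by apply/eqP => /quot_piP; rewrite subr0; apply: Spec_unit.
have st x : exists n, x <= quot_pi p u *+ n.
  elim/quot_piW: x => x; have [n xn] := strong x.
  by exists n; rewrite -(vlhomMn pih); apply: vlhom_le.
have [r] := totally_ordered_archimedean_line tot arch pu st (quot_pi p v).
by rewrite -quot_piZ => /quot_piP; exists r.
Qed.

Definition Spec_value v p : R := projT1 (cid (Spec_value_ex p v)).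

(** Two distinct values would put a nonzero multiple of [u], hence [u], in [p]. *)
Lemma Spec_valueP v p r : p (v - r *: u) <-> Spec_value v p = r.
Proof.
rewrite /Spec_value; case: cid => s /= ps; split=> [pr|<- //].
apply/eqP; apply: contrapT => /negP sr; apply: (@Spec_unit _ _ _ p).
have := vlidealB pr ps; rewrite opprB addrC addrA subrK -scalerBl => psr.
have := vlidealZ (s - r)^-1 psr.
by rewrite scalerA mulVf ?scale1r// subr_eq0.
Qed.

Lemma Spec_valueK v p : p (v - Spec_value v p *: u).
Proof. exact/Spec_valueP. Qed.

Lemma Spec_value_pi v p r :
  Spec_value v p = r <-> quot_pi p v = r *: quot_pi p u.
Proof.
rewrite -quot_piZ; split=> [/Spec_valueP|h]; first by move/quot_piP.
exact/Spec_valueP/quot_piP.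
Qed.

Lemma Spec_value_locally_constant v : Spec_value v \in @lc_pred (Spec u) R.
Proof.
apply/lc_predP => p; exists [set q : Spec u | q (v - Spec_value v p *: u)].
  by split; [case: (Spec_clopen (v - Spec_value v p *: u))|apply: Spec_valueK].
by move=> q /Spec_valueP.
Qed.

Definition Spec_hat v : LC (Spec u) R := MkLC (Spec_value_locally_constant v).

Lemma Spec_hat_uvlhom : is_uvlhom u (LC_one (Spec u) R) Spec_hat.
Proof.
(* Modulo [p] both elements are multiples of a nonnegative [u], so meets are computed on
   coefficients. *)
have hI v w : Spec_hat (v `&` w)%O = (Spec_hat v `&` Spec_hat w)%O.
  apply: LC_eqP => p; apply/Spec_value_pi.
  rewrite (vlhomI (quot_pi_vlhom p)).
  have /Spec_value_pi -> := erefl (Spec_value v p).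
  have /Spec_value_pi -> := erefl (Spec_value w p).
  have pu : 0 <= quot_pi p u.
    by rewrite -(vlhom0 (quot_pi_vlhom p)) (vlhom_le (quot_pi_vlhom p)).
  change (Spec_value v p *: quot_pi p u `&` Spec_value w p *: quot_pi p u =
    Num.min (Spec_value v p) (Spec_value w p) *: quot_pi p u)%O.
  have [vw|wv] := leP (Spec_value v p) (Spec_value w p).
    by rewrite meet_l// lev_scalel.
  by rewrite meet_r// lev_scalel// ltW.
have hlin : linear Spec_hat.
  move=> r v w; apply: LC_eqP => p; apply/Spec_valueP.
  change (p (r *: v + w - (r * Spec_value v p + Spec_value w p) *: u)).
  rewrite scalerDl -scalerA opprD addrACA -scalerBr.
  by apply: vlidealD; [apply: vlidealZ|]; apply: Spec_valueK.
split; last first.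
  apply: LC_eqP => p; apply/Spec_valueP; rewrite scale1r subrr.
  by apply: vlideal0.
split=> // v w.
have hN x : Spec_hat (- x) = - Spec_hat x.
  have h0 : Spec_hat 0 = 0.
    by have := hlin (-1) 0 0; rewrite scaleN1r oppr0 addr0 scaleN1r addNr.
  by have := hlin (-1) x 0; rewrite h0 !addr0 !scaleN1r.
by rewrite joinv_oppE hN hI !hN -joinv_oppE.
Qed.

(** A totally ordered quotient in which [absv v] survives comes from a point of the spectrum: as [u]
    is strong, [a <= nu] gives [a <= n(a /\ u)], which is the unit condition. *)
Lemma Spec_hat_eq0 v : Spec_hat v = 0 -> v = 0.
Proof.
move=> v0; apply: absv_eq0; apply: contrapT => /eqP av0.
have av : 0 < absv v by rewrite lt_def av0 absv_ge0.
have [K [nKv totK]] := exists_prime_vlideal av.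
have Ku a : 0 <= a -> K (a `&` u)%O -> K a.
  move=> a0 Kau; have [n an] := strong a.
  apply: (vlideal_le a0 _ (vlidealMn n Kau)).
  by rewrite -[X in X <= _](meet_l an) meetv_mulrn.
have prK : prime_ideal (Ideal Ku) by split=> //; exists (absv v).
pose p := MkSpec prK.
apply: nKv; apply/vlideal_abs.
have /Spec_valueP : Spec_value v p = 0 := congr1 (fun h : LC _ _ => h p) v0.
by rewrite scale0r subr0.
Qed.

Lemma Spec_hat_separates p q : p <> q ->
  exists v, Spec_hat v p <> Spec_hat v q.
Proof.
move=> pq; apply: contrapT => nsep; apply: pq; apply: Spec_ext => a.
have e : Spec_value a p = Spec_value a q.
  by apply: contrapT => h; apply: nsep; exists a.
by rewrite -[a]subr0 -(scale0r u) !Spec_valueP e.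
Qed.

Lemma hyperarchimedean_isomorphic_LC : uvl_isomorphic u (LC_one (Spec u) R).
Proof.
apply: (uvl_isomorphic_bij Spec_hat_uvlhom Spec_hat_eq0).
apply: (LC_dense (@Spec_compact _ _ u) Spec_hat_uvlhom Spec_hat_separates).
Qed.

End SpectrumOfHyperarchimedean.

(** * The spectrum of a lattice of locally constant functions *)

Section MaximalSpectrumOfLC.
Local Open Scope classical_set_scope.
Variables (R : realType) (V : vectorLatticeType R) (u : V).
Variables (X : topologicalType).
Variables (f : V -> LC X R) (g : LC X R -> V).
Hypotheses (hu : weak_unit u) (bX : boolean_space X).
Hypotheses (fu : is_uvlhom u (LC_one X R) f).
Hypotheses (gh : is_vlhom g) (fK : cancel f g) (gK : cancel g f).
Implicit Types (x y : X) (a b c : V).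

Let fh : is_vlhom f. Proof. by case: fu. Qed.
Let cX : compact [set: X]. Proof. by case: bX. Qed.

Let f1 x : f u x = 1. Proof. by case: fu => _ ->. Qed.
Let fI a b x : f (a `&` b)%O x = Num.min (f a x) (f b x).
Proof. by rewrite (vlhomI fh). Qed.
Let fU a b x : f (a `|` b)%O x = Num.max (f a x) (f b x).
Proof. by rewrite (vlhomU fh). Qed.
Let fB a b x : f (a - b) x = f a x - f b x.
Proof. by rewrite (vlhomB fh). Qed.
Let fZ r a x : f (r *: a) x = r * f a x.
Proof. by rewrite (vlhomZ fh). Qed.
Let f_le a b x : a <= b -> f a x <= f b x.
Proof. by move=> /(vlhom_le fh)/LC_leP; apply. Qed.
Let f0 x : f 0 x = 0. Proof. by rewrite (vlhom0 fh). Qed.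

Section Point.
Variable x : X.
Let K a := f a x = 0.
Let K0 : K 0. Proof. exact: f0. Qed.
Let KB a b : K a -> K b -> K (a - b).
Proof. by rewrite /K fB => -> ->; rewrite subrr. Qed.
Let KI a b : K a -> K b -> K (a `&` b)%O.
Proof. by rewrite /K fI => -> ->; rewrite minxx. Qed.
Let KU a b : K a -> K b -> K (a `|` b)%O.
Proof. by rewrite /K fU => -> ->; rewrite maxxx. Qed.
Let Kc a b c : K a -> K c -> a <= b -> b <= c -> K b.
Proof.
move=> Ka Kc /(f_le x) ab /(f_le x) bc; apply/eqP.
by rewrite eq_le -{1}Kc -Ka ab bc.
Qed.
Let Ku a : 0 <= a ->
  VLIdeal K0 KB KI KU Kc (a `&` u)%O -> VLIdeal K0 KB KI KU Kc a.
Proof.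
move=> _ /=; rewrite /K fI f1 /Num.min; case: ifP => // _ /eqP.
by rewrite oner_eq0.
Qed.

Definition point_ideal : ideal u := Ideal Ku.

(** Classes are ordered as the values at [x], so totality and the Archimedean property come from the
    reals. *)
Lemma point_ideal_maximal : maximal_ideal point_ideal.
Proof.
split.
- by exists u; rewrite /= /K f1 => /eqP; rewrite oner_eq0.
- apply: totally_ordered_quot => a; rewrite /= /K !fU f0.
  have -> : f (- a) x = - f a x by rewrite (vlhomN fh).
  have [a0|a0] := leP (f a x) 0; first by left.
  by right; rewrite max_r// oppr_le0 ltW.
have pi_le a b :
    (quot_pi point_ideal a <= quot_pi point_ideal b) <-> f a x <= f b x.
  rewrite quot_pi_le /= /K fU f0 fB -subr_le0.
  split=> [<-|?]; last by rewrite max_r.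
  by rewrite le_max lexx.
elim/quot_piW => a; elim/quot_piW => b a0 /pi_le ab.
have pi0 := vlhom0 (quot_pi_vlhom point_ideal).
have ax : 0 < f a x.
  rewrite -(f0 x) ltNge; apply/negP => /pi_le; rewrite pi0 => /(lt_le_trans a0).
  by rewrite ltxx.
have bx : 0 <= f b x / f a x by rewrite divr_ge0// ?ltW// (lt_le_trans ax).
(* The successor ensures that the integer is positive. *)
exists (Num.bound (f b x / f a x)).+1 => //; apply/negP.
rewrite -(vlhomMn (quot_pi_vlhom point_ideal)) => /pi_le.
rewrite (vlhomMn fh) LC_mulrnE -mulr_natl -ler_pdivlMr//.
apply/negP; rewrite -ltNge; apply: lt_trans (archi_boundP bx) _.
by rewrite ltr_nat.
Qed.

End Point.

Definition point_Spec x : Spec u :=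
  MkSpec (let: And3 pr tot _ := point_ideal_maximal x in conj pr tot).

Definition point_MaxSpec x : MaxSpec u :=
  exist _ (point_Spec x) (mem_set (point_ideal_maximal x)).

Lemma Spec_point (p : Spec u) : exists x, p = point_Spec x.
Proof.
suff [x px] : exists x, forall a, p a -> f a x = 0.
  exists x; apply: Spec_ext => a; split=> [/px//|fa].
  (* The indicator of the zero set of [a] is disjoint from [absv a] and is [1] at [x], so it is
     outside [p]. *)
  pose h := g (LC_indicator R (clopen_LC_preimage (f a) [set 0])).
  have hx : f h x = 1 by rewrite gK /= asboolT.
  have /Spec_meet[/vlideal_abs//|/px] : p (absv a `&` h)%O.
    have -> : (absv a `&` h)%O = 0.
      rewrite -[LHS]fK -[RHS]fK; congr g; apply: LC_eqP => y.
      rewrite f0 fI /h gK /= fU (vlhomN fh) -[(- f a) y]/(- f a y).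
      have [ay|ay] := eqVneq (f a y) 0.
        by rewrite ay oppr0 maxxx min_l// ler0n.
      rewrite asboolF; last exact/eqP.
      by rewrite min_r// le_max oppr_ge0 le_total.
    exact: vlideal0.
  by rewrite hx => /eqP; rewrite oner_eq0.
apply: contrapT => nx.
(* Without a common zero, members of [p] rescale to [1] near each point and glue by joins into one
   above [u]. *)
pose P (A : set X) := exists2 a, p a & forall x, A x -> 1 <= f a x.
have [|A B AB|A B|x|a pa fa] := @compact_local_induction X P cX.
- by exists 0 => //; apply: vlideal0.
- by move=> [a pa fa]; exists a => // x /AB/fa.
- move=> [a pa fa] [b pb fb]; exists (a `|` b)%O; first exact: vlidealU.
  by move=> x; rewrite fU le_max => -[/fa ->//|/fb ->]; rewrite orbT.
- have [a pa ax] : exists2 a, p a & f a x <> 0.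
    by apply: contrapT => na; apply: nx; exists x => a pa;
      apply: contrapT => ?; apply: na; exists a.
  have [U xU aU] := LC_locally (f a) x; exists U => //.
  exists ((f a x)^-1 *: a); first exact: vlidealZ.
  by move=> y /aU fy; rewrite fZ fy mulVf//; apply/eqP.
apply: (@Spec_unit _ _ _ p); apply: (vlideal_le _ _ pa).
  by case: hu.
rewrite -[u]fK -[a]fK; apply: (vlhom_le gh); apply/LC_leP => x.
by rewrite f1 fa.
Qed.

Lemma LC_homeomorphic_MaxSpec : homeomorphic X (MaxSpec u).
Proof.
have /choice[k kE] (m : MaxSpec u) : exists x, m = point_MaxSpec x.
  have [x mx] := Spec_point (val m); exists x; exact/val_inj.
(* The indicator of the complement of a separating clopen set vanishes at [x] but not at [y]. *)
have sep x y : (forall a, f a x = 0 -> f a y = 0) -> x = y.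
  apply: contraPeq => /(compact_totally_disconnected_zero_dimensional bX).
  move=> [C [clC Cx nCy]] /(_ (g (LC_indicator R (clopenC set0 clC)))).
  rewrite !gK /= asboolF; last by apply.
  by rewrite asboolT// => /(_ erefl) /eqP; rewrite oner_eq0.
exists point_MaxSpec, k; split.
- move=> x; apply: sep => a; have := kE (point_MaxSpec x).
  by move=> /(congr1 (fun m => Spec_ideal (val m) a)) /= <-.
- by move=> m; rewrite -kE.
- apply: continuous_comp_initial => x A /Spec_nbhsP[a nfa aA].
  apply: (@filterS _ _ _ [set y | f a y <> 0]).
    by move=> y fay; apply: aA.
  apply: open_nbhs_nbhs; split=> //.
  by have [] := clopen_LC_preimage (f a) (~` [set 0]).
(* For the inverse, the indicator [h] of a clopen neighbourhood [C] of [k m] gives the open set of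
   ideals missing [h], which [k] maps into [C]. *)
- move=> m A; rewrite nbhsE => -[U /(clopen_nbhs_basis bX)[C [clC Cm CU]] UA].
  pose h := g (LC_indicator R clC).
  have kh (m' : MaxSpec u) : ~ (val m') h <-> C (k m').
    rewrite {1}(kE m') /= gK /=; have [Cm'|nCm'] := pselect (C (k m')).
      by rewrite asboolT//; split=> // _ /eqP; rewrite oner_eq0.
    by rewrite asboolF//; split.
  apply: (@filterS _ _ _ [set m' : MaxSpec u | ~ val m' h]).
    by move=> m' /kh/CU/UA.
  have nh : nbhs (val m) [set p : Spec u | ~ p h].
    by apply/Spec_nbhsP; exists h => //; apply/kh.
  exact: (@initial_continuous _ _
    (@set_val _ [set p : Spec u | maximal_ideal p]) m _ nh).
Qed.

End MaximalSpectrumOfLC.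

Theorem theorem3p5 (R : realType) (V : vectorLatticeType R) (u : V)
    (hu : weak_unit u) :
  (hyperarchimedean V <->
   exists X : topologicalType,
     boolean_space X /\ uvl_isomorphic u (LC_one X R)) /\
  (forall X : topologicalType,
     boolean_space X -> uvl_isomorphic u (LC_one X R) ->
     homeomorphic X (MaxSpec u)) /\
  (forall X Y : topologicalType,
     boolean_space X -> uvl_isomorphic u (LC_one X R) ->
     boolean_space Y -> uvl_isomorphic u (LC_one Y R) ->
     homeomorphic X Y).
Proof.
have max (X : topologicalType) : boolean_space X ->
    uvl_isomorphic u (LC_one X R) -> homeomorphic X (MaxSpec u).
  move=> bX [f [g [fu [gh _] fK gK]]].
  exact: (LC_homeomorphic_MaxSpec hu bX fu gh fK gK).
split; last first.
  split=> // X Y bX iX bY iY.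
  exact: homeomorphic_trans (max X bX iX) (homeomorphic_sym (max Y bY iY)).
split=> [hyp|[X [[cX _ _] [f [g [[fh _] _ fK _]]]]]].
  exists (Spec u); split; first exact: Spec_boolean.
  exact: hyperarchimedean_isomorphic_LC.
(* Disjointness is pulled back from [LC X] along the injective [f]. *)
apply: stabilizing_hyperarchimedean => a b a0 b0.
have fpos c : 0 <= c -> 0 <= f c by move=> /(vlhom_le fh); rewrite (vlhom0 fh).
have [n abn] := compact_stabilizing_LC cX (fpos a a0) (fpos b b0).
exists n; apply: (can_inj fK).
by rewrite (vlhomI fh) (vlhom_pos fh) (vlhomB fh) (vlhomMn fh) (vlhom0 fh).
Qed.
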